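(* Let $M$ be a complete connected noncompact Riemannian manifold satisfying the volume doubling property (D), the Relative Connectedness in the Ends condition (RCE), and the reverse doubling condition (RD) for an exponent $\nu>1$. Let $1\le p<\nu$, and assume that the $L^p$ Poincaré inequality in the ends $(\mathrm{P}^E_p)$ holds. Then the $L^p$ Hardy inequality holds on $M$: there is a constant $C>0$ such that $$\int_M\left(\frac{|f|}{r+1}\right)^p d\mu\le C\int_M|df|^p\,d\mu\qquad\text{for all } f\in C_0^\infty(M),$$ where $r(x)=d(x,o)$ is the distance to a fixed point $o\in M$.
   Context: $\mu$ is the Riemannian measure, $d$ the geodesic distance, $\nabla$ the gradient ($|df|=|\nabla f|$). $B(x,r)$ is the open geodesic ball and $V(x,r)=V(B(x,r))=\mu(B(x,r))$. A point $o\in M$ is fixed and $r(x)=d(x,o)$. The notation $A\lesssim B$ means $A\le CB$ with a constant $C>0$ independent of the indicated variables. (D): $V(x,2r)\lesssim V(x,r)$ for all $x\in M$, $r>0$. (RD) with exponent $\nu>0$: $(R/r)^{\nu}V(x,r)\lesssim V(x,R)$ for all $x\in M$, $0<r<R$. Admissible balls: fix a sufficiently large $r_0>0$. The ball $B(x,r)$ is remote if $r\le r(x)/2$, anchored if $x=o$, and admissible if it is remote, or anchored with $r\le r_0$. $(\mathrm{P}^E_p)$ ($L^p$ Poincaré inequality in the ends): for every admissible ball $B$ of radius $r$ and every $f\in C^\infty(B)$, $\|f-f_B\|_{L^p(B)}\lesssim r\|\nabla f\|_{L^p(B)}$, with constant independent of $f$ and $B$, where $f_B=V(B)^{-1}\int_B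 f\,d\mu$. (RCE): $M$ has a finite number of ends (there is an integer $N\ge1$ such that for all $R>0$, $M\setminus B(o,R)$ has at most $N$ unbounded connected components; this is implied by (D)), and there is $\theta\in(0,1)$ such that for every $x$ with $r(x)\ge1$ there is a continuous path $c:[0,1]\to M$ with $c(0)=x$, length at most $r(x)/\theta$, $c([0,1])\subset B(o,\theta^{-1}r(x))\setminus B(o,\theta r(x))$, and a geodesic ray $\gamma:[0,+\infty)\to M\setminus B(o,r(x))$ with $\gamma(0)=c(1)$. *)

(* Defs.v *)
From HB Require Import structures.
From mathcomp Require Import all_boot all_order all_algebra.
From mathcomp Require Import all_classical all_reals all_analysis.
Set Implicit Arguments.
Unset Strict Implicit.
Unset Printing Implicit Defensive.
Import Order.TTheory GRing.Theory Num.Theory.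
Import numFieldNormedType.Exports.
Local Open Scope classical_set_scope.
Local Open Scope ring_scope.

(* Generated sigma-algebras are only available on pointed types. *)
#[short(type="pmetricType")]
HB.structure Definition PointedMetric (K : numDomainType) :=
  {M of Metric K M & isPointed M}.

Definition borel {R : realType} (M : pmetricType R) :=
  g_sigma_algebraType (@open M).

Section EuclideanCalculus.
Context {R : realType} {n : nat}.

(* Meant for open U: total derivatives exist on U and all the iterated
   directional derivatives up to order k are continuous on U. *)
Fixpoint Ck_on (V : normedModType R) (k : nat) (U : set 'rV[R]_n)
    (f : 'rV[R]_n -> V) : Prop :=
  match k with
  | 0%N => forall y, U y -> {for y, continuous f}
  | k'.+1 => (forall y, U y -> differentiable f y) /\
      forall v : 'rV[R]_n, Ck_on k' U (fun y => 'D_v f y)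
  end.

Definition Cinfty_on (V : normedModType R) (U : set 'rV[R]_n)
  (f : 'rV[R]_n -> V) : Prop := forall k, Ck_on k U f.

End EuclideanCalculus.

(* The Lebesgue integral over R^n as an iterated integral; by Tonelli the two
   agree on nonnegative Borel functions, the only ones it is applied to. *)
Fixpoint lebesgue_rV {R : realType} (n : nat) :
    ('rV[R]_n -> \bar R) -> \bar R :=
  match n with
  | 0%N => fun h => h 0
  | m.+1 => fun h => (\int[lebesgue_measure]_(t in [set: R])
      lebesgue_rV (fun v : 'rV[R]_m => h (row_mx (t%:M : 'rV[R]_1) v)))%E
  end.

(* A smooth n-dimensional manifold with a Riemannian metric, on the topology
   of M (Hausdorff, since M is a metric space). The smooth structure is given
   by an atlas, and the Riemannian metric by its Gram matrices in the charts;
   tangent vectors are represented as row vectors in a chart. *)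
Record riemannian_structure {R : realType} (n : nat) (M : pmetricType R) := {
  chart : Type ;
  dom : chart -> set M ;
  coord_map : chart -> M -> 'rV[R]_n ;
  param : chart -> 'rV[R]_n -> M ;
  gram : chart -> 'rV[R]_n -> 'M[R]_n ;
  chart_at : M -> chart ;

  second_countableM : @second_countable M ;
  dom_chart_at : forall x, dom (chart_at x) x ;
  open_dom : forall i, open (dom i) ;
  open_image : forall i, open (coord_map i @` dom i) ;
  coord_mapK : forall i x, dom i x -> param i (coord_map i x) = x ;
  coord_map_continuous : forall i x, dom i x ->
    {for x, continuous (coord_map i)} ;
  param_continuous : forall i y, (coord_map i @` dom i) y ->
    {for y, continuous (param i)} ;
  transition_smooth : forall i j,
    Cinfty_on (coord_map i @` (dom i `&` dom j)) (coord_map j \o param i) ;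

  gram_smooth : forall i, Cinfty_on (coord_map i @` dom i) (gram i) ;
  gram_sym : forall i y, (coord_map i @` dom i) y -> (gram i y)^T = gram i y ;
  gram_pos : forall i y, (coord_map i @` dom i) y ->
    forall u : 'rV[R]_n, u != 0 -> 0 < (u *m gram i y *m u^T) 0 0 ;
  gram_transition : forall i j y, (coord_map i @` (dom i `&` dom j)) y ->
    forall u v : 'rV[R]_n,
      (u *m gram i y *m v^T) 0 0 =
      ('d (coord_map j \o param i) y u
         *m gram j (coord_map j (param i y))
         *m ('d (coord_map j \o param i) y v)^T) 0 0
}.

Section RiemannianGeometry.
Context {R : realType} {n : nat} {M : pmetricType R}.
Variable S : riemannian_structure n M.

Definition tangent_norm (i : chart S) (y u : 'rV[R]_n) : R :=
  Num.sqrt ((u *m gram i y *m u^T) 0 0).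

Definition smooth_on (U : set M) (f : M -> R) : Prop :=
  forall i : chart S,
    Cinfty_on (coord_map i @` (dom i `&` U)) (f \o param i : _ -> R^o).

(* The components of the gradient of f at x in the chart chart_at S x,
   i.e. g^{ab} d_b f. *)
Definition gradient (f : M -> R) (x : M) : 'rV[R]_n :=
  let i := chart_at S x in let y := coord_map i x in
  (\row_(a < n) 'D_(delta_mx 0 a) (f \o param i : _ -> R^o) y)
    *m invmx (gram i y).

Definition norm_gradient (f : M -> R) (x : M) : R :=
  let i := chart_at S x in tangent_norm i (coord_map i x) (gradient f x).

(* C^1 up to the end points of [0, 1], in the sense of admitting a C^1
   extension to a neighbourhood of [0, 1]. *)
Definition C1_arc (c : R -> M) : Prop :=
  forall t, 0 <= t <= 1 ->
    {for t, continuous c} /\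
    forall i : chart S, dom i (c t) ->
      (\forall s \near t, derivable (coord_map i \o c : R^o -> _) s 1) /\
      {for t, continuous (fun s => 'D_1 (coord_map i \o c : R^o -> _) s)}.

Definition speed (c : R -> M) (t : R) : R :=
  let i := chart_at S (c t) in
  tangent_norm i (coord_map i (c t)) ('D_1 (coord_map i \o c : R^o -> _) t).

Definition arc_length (c : R -> M) : \bar R :=
  (\int[lebesgue_measure]_(t in `[0%R, 1%R]) (speed c t)%:E)%E.

(* Piecewise C^1 curves from x to y of length l, as finite concatenations of
   C^1 arcs. *)
Inductive piecewise_C1_curve : M -> M -> \bar R -> Prop :=
| curve_nil x : piecewise_C1_curve x x 0%E
| curve_cons (c : R -> M) y l : C1_arc c -> piecewise_C1_curve (c 1) y l ->
    piecewise_C1_curve (c 0) y (arc_length c + l)%E.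

(* A connected Riemannian manifold is treated as the metric space it is for its
   geodesic distance, which induces the manifold topology. Hence the carrier
   is a metric space, and this condition says that its distance is the
   infimum of the lengths of piecewise C^1 curves. *)
Definition is_geodesic_distance : Prop :=
  forall x y : M,
    (mdist x y)%:E = ereal_inf [set l | piecewise_C1_curve x y l].

(* In every chart, d(mu) = sqrt(det g) dy. This determines mu, as M is covered
   by countably many charts. *)
Definition is_riemannian_measure (mu : {measure set (borel M) -> \bar R}) :
    Prop :=
  forall (i : chart S) (A : set M), measurable (A : set (borel M)) ->
    A `<=` dom i ->
    mu A = lebesgue_rV (fun y : 'rV[R]_n =>
      (Num.sqrt (\det (gram i y)) * \1_(coord_map i @` A) y)%:E).

End RiemannianGeometry.

Section Conditions.
Context {R : realType} {n : nat} {M : pmetricType R}.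
Variables (S : riemannian_structure n M).
Variables (mu : {measure set (borel M) -> \bar R}) (o : M).

Definition complete_space : Prop :=
  forall F : set_system M, ProperFilter F -> cauchy F -> cvg F.

Definition volume (x : M) (r : R) : \bar R := mu (ball x r).

Definition doubling : Prop :=
  exists2 C : R, 0 < C & forall (x : M) (r : R), 0 < r ->
    (volume x (2 * r) <= C%:E * volume x r)%E.

Definition reverse_doubling (nu : R) : Prop :=
  exists2 C : R, 0 < C & forall (x : M) (r r' : R), 0 < r -> r < r' ->
    (((r' / r) `^ nu)%:E * volume x r <= C%:E * volume x r')%E.

Definition bounded_subset (A : set M) : Prop := exists r : R, A `<=` ball o r.

Definition finitely_many_ends : Prop :=
  exists2 N : nat, (1 <= N)%N & forall r : R, 0 < r ->
    ([set A | exists2 x, (~` ball o r) x &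
                A = connected_component (~` ball o r) x /\ ~ bounded_subset A]
      #<= `I_N)%card.

(* The paths of RCE are only continuous, so their length is the supremum of
   the lengths of inscribed polygons. *)
Definition path_length_le (c : R -> M) (l : R) : Prop :=
  forall (m : nat) (u : nat -> R),
    {homo u : j k / (j <= k)%N >-> j <= k} -> (forall k, 0 <= u k <= 1) ->
    \sum_(k < m) mdist (c (u k)) (c (u k.+1)) <= l.

(* Rays are unit-speed and minimizing between any two of their points. *)
Definition geodesic_ray (c : R -> M) : Prop :=
  forall s t, 0 <= s -> 0 <= t -> mdist (c s) (c t) = `|s - t|.

Definition RCE : Prop :=
  finitely_many_ends /\
  exists2 theta : R, 0 < theta < 1 &
    forall x : M, 1 <= mdist x o ->
      exists c : R -> M,
        [/\ {within `[0, 1], continuous c}, c 0 = x,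
            path_length_le c (mdist x o / theta),
            forall t, 0 <= t <= 1 ->
              ball o (theta^-1 * mdist x o) (c t) /\
              ~ ball o (theta * mdist x o) (c t) &
            exists2 ray : R -> M, geodesic_ray ray &
              ray 0 = c 1 /\
              forall t, 0 <= t -> ~ ball o (mdist x o) (ray t)].

Definition admissible (r0 : R) (x : M) (r : R) : Prop :=
  0 < r /\ (r <= mdist x o / 2 \/ (x = o /\ r <= r0)).

Definition mean (B : set M) (f : M -> R) : R :=
  (fine (mu B))^-1 * Rintegral mu B f.

Definition Lp_norm (p : R) (B : set M) (f : M -> R) : \bar R :=
  Lnorm mu p%:E (EFin \o (f \_ B)).

(* Integrability is what makes the mean of f over the ball meaningful: a smooth
   function on an open ball may blow up at the boundary. *)
Definition poincare_in_ends (r0 p : R) : Prop :=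
  exists2 C : R, 0 < C & forall (x : M) (r : R), admissible r0 x r ->
    forall f : M -> R, smooth_on S (ball x r) f ->
      mu.-integrable (ball x r) (EFin \o f) ->
      (Lp_norm p (ball x r) (fun z => f z - mean (ball x r) f)%R
       <= (C * r)%:E * Lp_norm p (ball x r) (norm_gradient S f))%E.

Definition hardy (p : R) : Prop :=
  exists2 C : R, 0 < C & forall f : M -> R, smooth_on S [set: M] f ->
    compact (closure [set x | f x != 0]) ->
    (\int[mu]_x ((`|f x| / (mdist x o + 1)) `^ p)%:E
     <= C%:E * \int[mu]_x (norm_gradient S f x `^ p)%:E)%E.

End Conditions.

(* Main.v *)
Require Import Defs.
From HB Require Import structures.
From mathcomp Require Import all_boot all_order all_algebra.
From mathcomp Require Import all_classical all_reals all_analysis.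
From mathcomp Require Import measurable_realfun perm ring lra.
Import Order.TTheory GRing.Theory Num.Theory.
Import numFieldNormedType.Exports.
Local Open Scope classical_set_scope.
Local Open Scope ring_scope.

(** A Hardy inequality compares [|f|] at distance about [t] from [o] with the
    gradient of [f] further out, where [f] eventually vanishes.  Write [rho x]
    for the distance from [x] to [o], and attach to a point [x] with
    [rho x >= 1] its normalized local average,
      [a(x) = |mean of f over B(x, theta/4 rho x)|^p V(o, rho x) / rho(x)^p].

    (RCE) joins [x] to a point [x'] with [rho x' = Lam * rho x] by a chain of
    boundedly many steps of length at most [theta/4 rho x]: along the path, then along
    the ray, every point staying at distance comparable to [rho x]
    ([RCE_chain]).  Balls around consecutive points of the chain lie in a common
    remote ball, so the Poincare inequality bounds the jump of the average by
    the energy of [f] in the shell of radius about [rho x] ([avg_sub_le]).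
    Passing from [x] to [x'] multiplies [V(o, rho) / rho^p] by at least a
    constant times [Lam^(nu - p)], by reverse doubling.  As [p < nu], a large
    [Lam] gives ([scaled_avg_decay])
      [a(x) <= a(x') / 2 + C * energy of f in the shell].
    Since [f] has compact support, the recursion ends, and summing it over the
    scales [Lam^k] absorbs the first term: [a] is bounded on the annuli
    [Lam^k <= rho < Lam^(k+1)] by numbers whose sum over [k] is controlled by
    the total energy, because the shells overlap at most four times
    ([halving_sum], [sum_band_le]).

    Doubling covers each annulus by boundedly many remote balls of comparable
    radius, so the integral of [(|f| / (rho + 1))^p] over the annulus is
    controlled by the energy and the bound for [a] there
    ([annulus_integral_le]).  The unit ball lies in an anchored ball, whose
    average is compared with that of one remote ball ([unit_ball_integral_le]);
    [R0] is chosen so that the anchored ball contains that remote ball.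

    The argument needs balls of positive finite measure.  If some ball is null,
    doubling makes [mu] vanish and the inequality is trivial; finiteness comes
    from the formula for the Riemannian measure in a chart around [o], again
    propagated by doubling. *)

(** * The integral of a nonnegative function as a lower integral *)

Section LowerIntegral.
Context {d : measure_display} {T : measurableType d} {R : realType}.
Variable mu : {measure set T -> \bar R}.
Local Open Scope ereal_scope.
Import HBNNSimple.

(** The integral of a nonnegative function is a supremum over the simple
    functions below it; this gives monotonicity, and superadditivity over
    disjoint sets, for functions and sets that are not known to be measurable,
    such as the gradient norm read in arbitrarily selected charts. *)
Lemma ge0_le_lower_integral (D E : set T) (f g : T -> \bar R) : D `<=` E ->
  (forall x, D x -> 0 <= f x) -> (forall x, E x -> 0 <= g x) ->
  (forall x, D x -> f x <= g x) ->
  \int[mu]_(x in D) f x <= \int[mu]_(x in E) g x.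
Proof.
move=> DE f0 g0 fg; rewrite !ge0_integralE//.
apply: ereal_sup_le => _ [h /= hf <-].
exists h => //= x; apply: (le_trans (hf x)).
rewrite !patchE; case: ifPn => [/set_mem xD|xD].
  by rewrite mem_set ?fg//; exact: DE.
by case: ifPn => // /set_mem; exact: g0.
Qed.

Let le_lower_integral_disjointT (D E : set T) (f : T -> \bar R) :
  (forall x, 0 <= f x) -> D `&` E = set0 ->
  \int[mu]_(x in D) f x + \int[mu]_(x in E) f x <= \int[mu]_x f x.
Proof.
move=> f0 DE.
have [->|fX] := eqVneq (\int[mu]_x f x) +oo; first by rewrite leey.
have fin A : \int[mu]_(x in A) f x \is a fin_num.
  rewrite ge0_fin_numE ?integral_ge0//; apply: (@le_lt_trans _ _ (\int[mu]_x f x)).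
    exact: ge0_le_lower_integral.
  by rewrite ltey.
rewrite -leeBrDr// [in leLHS]ge0_integralE//.
apply: ge_ereal_sup => _ [h /= hf <-].
have hX : sintegral mu h <= \int[mu]_(x in D) f x.
  by rewrite [leRHS]ge0_integralE//; apply: ereal_sup_ubound; exists h.
have hfin : sintegral mu h \is a fin_num.
  rewrite ge0_fin_numE ?sintegral_ge0//; apply: (le_lt_trans hX).
  by rewrite ltey_eq fin.
rewrite leeBrDr// addeC -leeBrDr// [in leLHS]ge0_integralE//.
apply: ge_ereal_sup => _ [k /= kf <-].
rewrite leeBrDr// addeC -sintegralD ge0_integralTE//; apply: ereal_sup_ubound.
exists (h \+ k)%R => // x /=; rewrite EFinD.
have := hf x; have := kf x; rewrite !patchE.
case: ifPn => [/set_mem xE|xE]; case: ifPn => [/set_mem xD|xD].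
- by have : (D `&` E) x by []; rewrite DE.
- by move=> kx hx; rewrite -[leRHS]add0e leeD.
- by move=> kx hx; rewrite -[leRHS]adde0 leeD.
- by move=> kx hx; rewrite (le_trans _ (f0 x))// -[leRHS]adde0 leeD.
Qed.

Lemma le_lower_integral_disjoint (D E F : set T) (f : T -> \bar R) :
  (forall x, 0 <= f x) -> D `<=` F -> E `<=` F -> D `&` E = set0 ->
  \int[mu]_(x in D) f x + \int[mu]_(x in E) f x <= \int[mu]_(x in F) f x.
Proof.
move=> f0 DF EF DE; rewrite [leRHS]integral_mkcond.
have restr A : A `<=` F -> \int[mu]_(x in A) f x = \int[mu]_(x in A) (f \_ F) x.
  move=> AF; apply: eq_integral => x /set_mem Ax.
  by rewrite patchE mem_set//; exact: AF.
rewrite (restr D)// (restr E)//; apply: le_lower_integral_disjointT => // x.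
exact: erestrict_ge0.
Qed.

End LowerIntegral.

(** * Local finiteness of the Riemannian measure *)

Section LocalFiniteness.
Context {R : realType}.

Lemma lebesgue_rV_ge0 {n : nat} (h : 'rV[R]_n -> \bar R) :
  (forall v, 0 <= h v)%E -> (0 <= lebesgue_rV h)%E.
Proof.
elim: n h => [|n IHn] h h0 /=; first exact: h0.
by apply: integral_ge0 => t _; apply: IHn.
Qed.

(** Tonelli for a box: integrating one coordinate at a time, each one contributes
    a factor [2 * eta]. *)
Lemma lebesgue_rV_le_box {n : nat} (y : 'rV[R]_n) (eta C : R)
    (h : 'rV[R]_n -> \bar R) : 0 <= eta -> 0 <= C ->
  (forall v, 0 <= h v <= C%:E)%E ->
  (forall v, h v != 0%E -> forall j, `|v 0 j - y 0 j| <= eta) ->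
  (lebesgue_rV h <= (C * (2 * eta) ^+ n)%:E)%E.
Proof.
move=> eta0; elim: n y C h => [|n IHn] y C h C0 hC hsupp.
  by rewrite /= expr0 mulr1; have /andP[] := hC 0.
pose z : 'rV[R]_n := \row_j y 0 (lift ord0 j).
pose I := `[y 0 0 - eta, y 0 0 + eta]%classic : set R.
have inner t : (lebesgue_rV (fun v : 'rV[R]_n => h (row_mx (t%:M : 'rV_1) v))
    <= ((if t \in I then C else 0) * (2 * eta) ^+ n)%:E)%E.
  apply: (IHn z) => [|v|v hvj j].
  - by case: ifP.
  - case: ifPn => [_|tI]; first exact: hC.
    have [->|hv] := eqVneq (h (row_mx t%:M v)) 0%E; first by rewrite lexx.
    exfalso; move/negP: tI; apply; apply/mem_set.
    have := hsupp _ hv ord0; rewrite /I /= in_itv/=.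
    have -> : row_mx (t%:M : 'rV[R]_1) v 0 ord0 = t.
      rewrite mxE; case: splitP => [j _|j]; last by rewrite /= => /eqP.
      by rewrite (ord1 j) mxE eqxx mulr1n.
    by rewrite ler_distl.
  - have lift0E : lift ord0 j = rshift 1 j by exact: val_inj.
    have rowE : (row_mx (t%:M : 'rV[R]_1) v : 'rV_n.+1) 0 (lift ord0 j) = v 0 j.
      exact: etrans (congr1 (row_mx (t%:M : 'rV[R]_1) v 0) lift0E) (row_mxEr _ _ _ _).
    have zE : z 0 j = y 0 (lift ord0 j) by rewrite mxE.
    by rewrite zE -rowE; exact: hsupp.
apply: (@le_trans _ _
    (\int[lebesgue_measure]_(t in I) (C * (2 * eta) ^+ n)%:E)%E); last first.
  rewrite integral_cst/=; last exact: measurable_itv.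
  rewrite /I lebesgue_measure_itv/= lte_fin.
  case: ltP => [eta2|eta2].
    rewrite -EFinB -EFinM lee_fin exprSr !mulrA.
    set X := C * _; rewrite le_eqVlt; apply/orP; left; apply/eqP.
    by rewrite -mulrA; congr (_ * _); lra.
  rewrite mule0 lee_fin mulr_ge0// exprn_ge0// mulr_ge0//.
rewrite [leRHS]integral_mkcond; apply: ge0_le_lower_integral => // t _.
- by apply: lebesgue_rV_ge0 => v; have /andP[] := hC (row_mx t%:M v).
- by rewrite patchE; case: ifP => // _; rewrite lee_fin mulr_ge0// exprn_ge0// mulr_ge0.
- by apply: (le_trans (inner t)); rewrite patchE; case: ifP => // _; rewrite mul0r.
Qed.

Lemma norm_det_le {n : nat} (B : R) (A : 'M[R]_n) :
  (forall a b, `|A a b| <= B) -> `|\det A| <= B ^+ n *+ #|{: {perm 'I_n}}|.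
Proof.
move=> AB; rewrite /determinant; apply: (le_trans (ler_norm_sum _ _ _)).
rewrite -sumr_const; apply: ler_sum => s _.
rewrite normrM normrX normrN1 expr1n mul1r normr_prod.
rewrite -[n in leRHS]card_ord -prodr_const.
by apply: ler_prod => a _; rewrite normr_ge0 AB.
Qed.

Lemma open_metric_ball {M : metricType R} (x : M) (r : R) : open (ball x r).
Proof.
rewrite openE => y; rewrite ballEmdist /= => xyr.
apply/nbhs_ballP; exists (r - mdist x y) => /=; first by rewrite subr_gt0.
move=> z; rewrite !ballEmdist/= ltrBrDl; apply: le_lt_trans.
exact: metric_triangle.
Qed.

Lemma measurable_ball {M : pmetricType R} (x : M) (r : R) :
  measurable (ball x r : set (borel M)).
Proof. by apply: sub_sigma_algebra; exact: open_metric_ball. Qed.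

Lemma mx_entry_le_norm {m n : nat} (A : 'M[R]_(m, n)) a b : `|A a b| <= `|A|.
Proof.
rewrite [`|A|]mx_normrE (le_trans _ (le_bigmax _ _ (a, b)))//.
Qed.

(** The Gram matrix is continuous, hence bounded near the image of [o] in a
    chart, so the volume density is bounded on a small ball whose image lies in
    a box. *)
Lemma riemannian_measure_locally_finite {n : nat} {M : pmetricType R}
    (S : riemannian_structure n M) (mu : {measure set (borel M) -> \bar R}) o :
  is_riemannian_measure S mu -> exists2 r : R, 0 < r & (volume mu o r < +oo)%E.
Proof.
move=> muS; pose i := chart_at S o; pose y := coord_map i o.
have oi : dom i o by exact: dom_chart_at.
have yi : (coord_map i @` dom i) y by exists o.
have gram_near : \forall z \near y, ball (gram i y) 1 (gram i z).
  by have /(_ _ (nbhsx_ballx _ _ ltr01)) := gram_smooth i 0 _ yi.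
have near_o : \forall x \near o, [/\ dom i x, ball y 1 (coord_map i x) &
    ball (gram i y) 1 (gram i (coord_map i x))].
  have ci := coord_map_continuous oi.
  have ball_near := ci _ (nbhsx_ballx y 1 ltr01).
  have gram_near_o := ci _ gram_near.
  near=> x; split.
  - by near: x; apply: open_nbhs_nbhs; split => //; exact: open_dom.
  - by near: x; exact: ball_near.
  - by near: x; exact: gram_near_o.
have [r /= r0 ro] : exists2 r : R, 0 < r & ball o r `<=`
    [set x | [/\ dom i x, ball y 1 (coord_map i x) &
      ball (gram i y) 1 (gram i (coord_map i x))]].
  by move/nbhs_ballP : near_o => [r r0 ro]; exists r.
exists r => //; rewrite /volume (muS i); last 2 first.
- exact: measurable_ball.
- by move=> x /ro[].
pose B := `|gram i y| + 1.
pose C := Num.sqrt (B ^+ n *+ #|{: {perm 'I_n}}|).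
apply: (@le_lt_trans _ _ (C * (2 * 1) ^+ n)%:E); last by rewrite ltry.
apply: (@lebesgue_rV_le_box _ y) => // [|v|v].
- by rewrite sqrtr_ge0.
- rewrite lee_fin mulr_ge0 ?sqrtr_ge0//= lee_fin indicE.
  case: (boolP (v \in _)) => [/set_mem[x /ro[_ _ gx] <-]|_]; last first.
    by rewrite mulr0 sqrtr_ge0.
  rewrite mulr1 ler_wsqrtr// (le_trans (ler_norm _))//; apply: norm_det_le => a b.
  move: gx; rewrite mx_norm_ball /ball_ /= => /(le_lt_trans (mx_entry_le_norm _ a b)).
  rewrite !mxE => gab.
  have := mx_entry_le_norm (gram i y) a b; move: gab; rewrite /B.
  set g := gram i y a b; set h := gram i _ a b => gh gB.
  rewrite -[h](subrKC g) (le_trans (ler_normD _ _))//.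
  by rewrite lerD// distrC ltW.
- rewrite indicE; case: (boolP (v \in _)) => [/set_mem[x /ro[_ yx _] <-] _ j|_].
    move: yx; rewrite mx_norm_ball /ball_ /= => /(le_lt_trans (mx_entry_le_norm _ 0 j)).
    by rewrite !mxE distrC => /ltW.
  by rewrite mulr0 eqxx.
Unshelve. all: by end_near. Qed.
End LocalFiniteness.

(** * Chains of points from (RCE) *)

Section MetricChains.
Context {R : realType}.

Lemma mdist_lipschitz {M : metricType R} (x y z : M) :
  `|mdist x y - mdist x z| <= mdist y z.
Proof.
rewrite ler_norml; have := metric_triangle x z y; have := metric_triangle x y z.
rewrite (metric_sym z y); lra.
Qed.

Lemma continuous_mdist {M : metricType R} (x : M) : continuous (mdist x : M -> R).
Proof.
move=> y; apply/cvgrPdist_lt => e e0; near=> z.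
rewrite (le_lt_trans (mdist_lipschitz _ _ _))//.
have : ball y e z by near: z; exact: nbhsx_ballx.
by rewrite ballEmdist.
Unshelve. all: by end_near. Qed.

(** Greedy subdivision: from [c t], move to a later point at distance exactly
    [delta], found by the intermediate value theorem, or jump to the end point
    once it is within [delta].  Each exact step uses up [delta] of the length,
    so at most [l / delta] of them can occur. *)
Lemma continuous_path_chain {M : pmetricType R} (c : R -> M) (l delta : R) (N : nat) :
  {within `[0, 1], continuous c} -> path_length_le c l -> 0 < delta ->
  l < N%:R * delta ->
  exists u : nat -> R, [/\ u 0 = 0, u N = 1, forall k, 0 <= u k <= 1 &
    forall k, mdist (c (u k)) (c (u k.+1)) <= delta].
Proof.
move=> cc cl delta0 lN.
have /choice[next nextP] : forall t : R, exists s, 0 <= t <= 1 ->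
    t <= s <= 1 /\ (s = 1 /\ mdist (c t) (c s) <= delta \/
      mdist (c t) (c s) = delta).
  move=> t; have [t01|t01] := pselect (0 <= t <= 1); last by exists 0.
  have [d1|d1] := leP (mdist (c t) (c 1)) delta.
    by exists 1 => _; case/andP : t01 => _ ->; rewrite lexx; split => //; left.
  have /andP[t0 t1] := t01.
  have gc : {within `[t, 1], continuous (mdist (c t) \o c)}.
    have /continuous_subspaceW tc : `[t, 1] `<=` `[0, 1].
      by apply: subset_itvr; rewrite bnd_simp.
    move=> s; apply: (@continuous_comp (subspace `[t, 1]) M R c (mdist (c t))).
      exact: (tc _ _ cc).
    exact: continuous_mdist.
  have [|s] := IVT t1 gc (v := delta).
    by rewrite /= mdistxx minEle maxEle mdist_ge0 (ltW d1) (ltW delta0).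
  by rewrite in_itv/= => ts sd; exists s; split => //; right.
pose u k := iter k next 0.
have u01 k : 0 <= u k <= 1.
  elim: k => [|k IHk]; first by rewrite /u/= lexx ler01.
  have [/andP[uk u1] _] := nextP _ IHk; have /andP[u0 _] := IHk.
  by rewrite /u iterS u1 (le_trans u0 uk).
have uS k : u k <= u k.+1 by have [/andP[] ] := nextP _ (u01 k).
have umono : {homo u : j k / (j <= k)%N >-> j <= k} by apply/nondecreasing_seqP.
exists u; split => //; last first.
  by move=> k; have [_ [[_ ud]|->]] := nextP _ (u01 k).
apply: contrapT => uN; have := cl N u umono u01; apply/negP; rewrite -ltNge.
apply: (lt_le_trans lN); rewrite mulr_natl -[N in leLHS]card_ord -sumr_const.
apply: ler_sum => k _; have [_ [[u1 _] | ->//]] := nextP _ (u01 k).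
exfalso; apply: uN; apply/eqP; rewrite eq_le; have /andP[_ ->] := u01 N => /=.
have uk1 : u k.+1 = 1 by []; rewrite -[leLHS]uk1; exact: umono.
Qed.

(** The path is followed first, then the ray up to the point where the distance
    to [o] reaches [Lam * mdist x o].  The number of steps is the same for all
    [x], because lengths and steps both scale with [mdist x o]. *)
Lemma RCE_chain {M : pmetricType R} (o : M) (theta Lam : R) :
  0 < theta < 1 -> 1 / theta <= Lam -> 
  (forall x : M, 1 <= mdist x o ->
      exists c : R -> M,
        [/\ {within `[0, 1], continuous c}, c 0 = x,
            path_length_le c (mdist x o / theta),
            forall t, 0 <= t <= 1 ->
              ball o (theta^-1 * mdist x o) (c t) /\
              ~ ball o (theta * mdist x o) (c t) &
            exists2 ray : R -> M, geodesic_ray ray &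
              ray 0 = c 1 /\
              forall t, 0 <= t -> ~ ball o (mdist x o) (ray t)]) ->
  exists N : nat, forall x : M, 1 <= mdist x o -> exists w : nat -> M,
    [/\ w 0%N = x, mdist (w N) o = Lam * mdist x o,
        forall k, mdist (w k) (w k.+1) <= theta / 4 * mdist x o &
        forall k, theta * mdist x o <= mdist (w k) o <= 3 * Lam * mdist x o].
Proof.
move=> /andP[theta0 theta1] Lamge H.
(* The path has length at most [mdist x o / theta], and the ray is followed
   during a time at most [2 * Lam * mdist x o]. *)
pose N1 := (Num.truncn (4 / theta ^+ 2)).+1.
pose N2 := (Num.truncn (8 * Lam / theta)).+1.
have Lam0 : 0 < Lam by apply: lt_le_trans Lamge; rewrite divr_gt0.
exists (N1 + N2)%N => x x1; have [c [cc c0 cl ctheta [ray rayP [ray0 rayx]]]] := H x x1.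
have x0 : 0 < mdist x o by lra.
set delta := theta / 4 * mdist x o.
have delta0 : 0 < delta by rewrite mulr_gt0// divr_gt0.
have [u [u0 uN u01 udelta]] : exists u : nat -> R,
    [/\ u 0 = 0, u N1 = 1, forall k, 0 <= u k <= 1 &
    forall k, mdist (c (u k)) (c (u k.+1)) <= delta].
  apply: (continuous_path_chain c _ _ _ cc cl delta0).
  rewrite [mdist x o / _]mulrC /delta mulrA ltr_pM2r//.
  rewrite -(ltr_pdivrMr _ _ (divr_gt0 theta0 (ltr0n _ 4))).
  apply: le_lt_trans (truncnS_gt _); rewrite le_eqVlt; apply/orP; left; apply/eqP.
  by field; lra.
have rho_ray t : 0 <= t -> mdist x o <= mdist (ray t) o.
  by move=> /rayx; rewrite ballEmdist /= metric_sym => /negP; rewrite -leNgt.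
have ray0le : mdist (ray 0) o <= Lam * mdist x o.
  have [] := ctheta 1; first by rewrite lexx ler01.
  rewrite ray0 ballEmdist /= metric_sym => /ltW/le_trans + _; apply.
  by rewrite ler_wpM2r ?mdist_ge0// -div1r.
have [T [T0 T2 rayT]] : exists T, [/\ 0 <= T, T <= 2 * Lam * mdist x o &
    mdist (ray T) o = Lam * mdist x o].
  have L0 : 0 <= 2 * Lam * mdist x o by rewrite !mulr_ge0// ltW.
  have rc : {within `[0, 2 * Lam * mdist x o],
      continuous (fun t => mdist o (ray (Num.max t 0)))}.
    apply: continuous_subspaceT => t; apply/cvgrPdist_lt => e e0; near=> s.
    rewrite (le_lt_trans (mdist_lipschitz _ _ _))// rayP ?le_max ?lexx ?orbT//.
    apply: (@le_lt_trans _ _ `|t - s|); last by near: s; exact: cvgr_dist_lt.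
    have := ler_norm (t - s); have := ler_norm (s - t); rewrite (distrC s) => ts st.
    by rewrite ler_norml !maxEle; do 2 case: ifPn; rewrite -?ltNge => ? ?;
      apply/andP; split; lra.
  have [|T] := IVT L0 rc (v := Lam * mdist x o).
    rewrite /= maxxx (max_idPl L0) ge_min le_max ![mdist o _]metric_sym ray0le/=.
    apply/orP; right.
    have := rayP _ _ L0 (lexx 0).
    have := metric_triangle (ray (2 * Lam * mdist x o)) o (ray 0).
    rewrite subr0 (ger0_norm L0) [mdist o (ray 0)]metric_sym; lra.
  rewrite in_itv/= => /andP[T0 T2]; rewrite (max_idPl T0) metric_sym => Tx.
  by exists T; split.
(* Times on the ray, constant once [T] is reached. *)
pose v (j : nat) := Num.min T (j%:R * delta).
have v0 j : 0 <= v j by rewrite le_min T0/= mulr_ge0// ltW.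
have v_0 : v 0%N = 0 by rewrite /v mul0r; apply/min_idPr.
have v_step j : `|v j - v j.+1| <= delta.
  rewrite /v -[j.+1]addn1 natrD mulrDl mul1r !minEle ler_norml.
  by do 2 case: ifPn; rewrite -?ltNge => ? ?; apply/andP; split; lra.
exists (fun k => if (k <= N1)%N then c (u k) else ray (v (k - N1)%N)); split.
- by rewrite /= u0.
- rewrite -{2}[N1]addn0 leq_add2l/= addKn -rayT; congr (mdist (ray _) o).
  apply/min_idPl; apply: (le_trans T2).
  rewrite /delta mulrA ler_pM2r// -(ler_pdivrMr _ _ (divr_gt0 theta0 (ltr0n _ 4))).
  apply/ltW; apply: le_lt_trans (truncnS_gt _); rewrite le_eqVlt; apply/orP; left.
  by apply/eqP; field; lra.
- move=> k; case: ltngtP => kN.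
  + by rewrite udelta.
  + rewrite rayP// subSn; last exact: ltnW.
    exact: v_step.
  + rewrite kN subSn// subnn uN -ray0 -(v_0) rayP//; exact: v_step.
- move=> k; case: ifP => _.
  + have [] := ctheta _ (u01 k); rewrite !ballEmdist/= metric_sym => /ltW a /negP.
    rewrite -leNgt => -> /=; apply: (le_trans a); rewrite ler_pM2r// -div1r; lra.
  + have rv := rho_ray _ (v0 (k - N1)%N); apply/andP; split.
      by rewrite (le_trans _ rv)// ger_pMl// ltW.
    have := metric_triangle (ray (v (k - N1)%N)) (ray 0) o.
    rewrite rayP// subr0 ger0_norm// => /le_trans; apply.
    have : v (k - N1)%N <= T by rewrite ge_min lexx.
    by lra.
Unshelve. all: by end_near. Qed.
End MetricChains.

(** * Inequalities for powers and mean values *)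

Section PowerInequalities.
Context {R : realType}.
Implicit Types x y a p : R.

Lemma ler_powR_base p x y : 0 <= p -> 0 <= x -> x <= y -> x `^ p <= y `^ p.
Proof.
move=> p0 x0 xy; apply: ge0_ler_powR => //; rewrite nnegrE//.
exact: le_trans xy.
Qed.

Lemma powR_add_le p x y : 0 <= p -> 0 <= x -> 0 <= y ->
  (x + y) `^ p <= 2 `^ p * (x `^ p + y `^ p).
Proof.
move=> p0; wlog xy : x y / x <= y => [H x0 y0|x0 y0].
  have [xy|/ltW yx] := leP x y; first exact: H.
  by rewrite addrC [X in _ * X]addrC; exact: H.
apply: (@le_trans _ _ ((2 * y) `^ p)); first by apply: ler_powR_base => //; lra.
by rewrite powRM// ler_wpM2l ?powR_ge0// lerDr powR_ge0.
Qed.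

(** A substitute for the tangent line of [x `^ p] at [a], sufficient for a
    Jensen inequality up to the constant [2 `^ p]. *)
Lemma powR_tangent_le p a x : 1 <= p -> 0 <= a -> 0 <= x ->
  a `^ (p - 1) * x <= x `^ p + a `^ p.
Proof.
move=> p1 a0 x0; have pB1 : 0 <= p - 1 by rewrite subr_ge0.
have p0 : 0 < p by exact: lt_le_trans p1.
have [xa|/ltW ax] := leP x a.
  rewrite -[leLHS]add0r lerD ?powR_ge0// -[leRHS]mulr_powRB1// mulrC.
  by rewrite ler_wpM2r ?powR_ge0.
rewrite -[leLHS]addr0 lerD ?powR_ge0// -[leRHS]mulr_powRB1// mulrC.
by rewrite ler_wpM2l// ler_powR_base.
Qed.

Lemma le_of_powR_le p x y : 0 < p -> 0 <= x -> x `^ p <= y -> x <= y `^ p^-1.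
Proof.
move=> p0 x0 xy; rewrite -[leLHS]powRr1// -(@mulfV _ p) ?gt_eqF// powRrM.
by apply: ler_powR_base => //; rewrite ?invr_ge0 ?powR_ge0// ltW.
Qed.

Lemma powRVK p y : 0 < p -> 0 <= y -> (y `^ p^-1) `^ p = y.
Proof. by move=> p0 y0; rewrite -powRrM mulVf ?gt_eqF// powRr1. Qed.

End PowerInequalities.

Section MeanValues.
Context {R : realType} {M : pmetricType R}.
Variable mu : {measure set (borel M) -> \bar R}.
Implicit Types (B : set (borel M)) (f h : borel M -> R).

Lemma integrable_bounded B f (b : R) : measurable B -> (mu B < +oo)%E ->
  measurable_fun [set: borel M] f -> (forall x, `|f x| <= b) ->
  mu.-integrable B (EFin \o f).
Proof.
move=> mB Boo mf fb; apply: measurable_bounded_integrable => //.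
  exact: measurable_funTS.
exists b; split; first exact: num_real.
by move=> c bc x _ /=; rewrite (le_trans (fb x))// ltW.
Qed.

Lemma integral_powR_split (p : R) B f (c : R) : 0 <= p -> measurable B ->
  measurable_fun [set: borel M] f ->
  (\int[mu]_(x in B) (`|f x| `^ p)%:E <=
   (2 `^ p)%:E * (\int[mu]_(x in B) (`|f x - c| `^ p)%:E + (`|c| `^ p)%:E * mu B))%E.
Proof.
move=> p0 mB mf.
have mpow (g : borel M -> R) : measurable_fun setT g ->
    measurable_fun B ((fun x => (`|g x| `^ p)%:E) : borel M -> \bar R).
  move=> mg; apply/measurable_EFinP; apply: measurable_funTS.
  apply: (measurableT_comp (measurable_powR p)).
  exact: measurableT_comp.
have mfc : measurable_fun setT ((fun x => f x - c) : borel M -> R).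
  exact: measurable_funB.
rewrite -integral_cst// -ge0_integralD//; last 2 first.
- exact: mpow.
- by move=> x _; rewrite lee_fin powR_ge0.
- rewrite -ge0_integralZl//.
  + apply: ge0_le_integral => //.
    * exact: mpow.
    * by apply: measurable_funeM; apply: emeasurable_funD => //; exact: mpow.
    * move=> x _; rewrite -EFinD -EFinM lee_fin.
      apply: le_trans (powR_add_le _ _ _ _ _ _) => //.
      by apply: ler_powR_base => //; rewrite -{1}[f x](subrK c) ler_normD.
  + by apply: emeasurable_funD => //; exact: mpow.
  + by move=> x _; rewrite -EFinD lee_fin addr_ge0// powR_ge0.
Qed.

(** Jensen's inequality up to a constant: [powR_tangent_le] is integrated with
    [x = |f - c|] and [a] half of [|mean - c|]. *)
Lemma mean_deviation (p : R) B f (c b : R) : 1 <= p -> measurable B ->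
  (0 < mu B < +oo)%E -> measurable_fun [set: borel M] f ->
  (forall x, `|f x| <= b) ->
  ((`|mean mu B f - c| `^ p)%:E * mu B <=
   (2 `^ p)%:E * \int[mu]_(x in B) (`|f x - c| `^ p)%:E)%E.
Proof.
move=> p1 mB /andP[B0 Boo] mf fb.
have p0 : 0 < p by exact: lt_le_trans p1.
have Bfin : mu B \is a fin_num by rewrite ge0_fin_numE.
have V0 : 0 < fine (mu B) by rewrite fine_gt0// B0.
rewrite -(fineK Bfin); set V := fine (mu B) in V0 *.
have mfc : measurable_fun setT ((fun x => f x - c) : borel M -> R).
  exact: measurable_funB.
have fcb x : `|f x - c| <= b + `|c|.
  by rewrite (le_trans (ler_normB _ _))// lerD2r.
have fi := integrable_bounded B f b mB Boo mf fb.
have ci : mu.-integrable B (EFin \o cst c).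
  by apply: (integrable_bounded B (cst c) `|c|).
have fci := integrable_bounded B _ _ mB Boo mfc fcb.
have nfc : measurable_fun setT ((fun x => `|f x - c|) : borel M -> R).
  exact: measurableT_comp.
have nfci : mu.-integrable B (EFin \o (fun x => `|f x - c|)).
  by apply: (integrable_bounded B _ (b + `|c|) mB Boo nfc) => x; rewrite normr_id.
set m := `|mean mu B f - c|.
have m0 : 0 <= m by exact: normr_ge0.
have mV : m * V <= Rintegral mu B (fun x => `|f x - c|).
  apply: le_trans (le_normr_Rintegral mB fci).
  rewrite RintegralB// Rintegral_cst//= -/V /m /mean -/V.
  rewrite -[X in _ * X](gtr0_norm V0) -normrM mulrBl mulrAC mulVf ?gt_eqF//.
  by rewrite mul1r.
pose a := m / 2; have a0 : 0 <= a by rewrite divr_ge0.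
have [Ioo|Ifin] := eqVneq (\int[mu]_(x in B) (`|f x - c| `^ p)%:E)%E +oo%E.
  by rewrite Ioo mulry gtr0_sg ?powR_gt0// mul1e leey.
have {}Ifin : (\int[mu]_(x in B) (`|f x - c| `^ p)%:E)%E \is a fin_num.
  by rewrite ge0_fin_numE ?ltey// integral_ge0// => x _; rewrite lee_fin powR_ge0.
have mpow : measurable_fun B ((fun x => (`|f x - c| `^ p)%:E) : borel M -> \bar R).
  apply/measurable_EFinP; apply: measurable_funTS.
  exact: (measurableT_comp (measurable_powR p)).
have key : ((a `^ (p - 1))%:E * \int[mu]_(x in B) (`|f x - c|)%:E <=
    \int[mu]_(x in B) (`|f x - c| `^ p)%:E + (a `^ p * V)%:E)%E.
  rewrite EFinM /V fineK// -integral_cst// -ge0_integralD//; last first.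
    by move=> x _; rewrite lee_fin powR_ge0.
  rewrite -ge0_integralZl//; last 2 first.
  - by apply/measurable_EFinP; exact: measurable_funTS.
  - by rewrite lee_fin powR_ge0.
  apply: ge0_le_integral => //.
  - by move=> x _; rewrite -EFinM lee_fin mulr_ge0// powR_ge0.
  - by apply: measurable_funeM; apply/measurable_EFinP; exact: measurable_funTS.
  - exact: emeasurable_funD.
  - by move=> x _; rewrite -EFinM -EFinD lee_fin powR_tangent_le.
have nfin : (\int[mu]_(x in B) (`|f x - c|)%:E)%E \is a fin_num.
  exact: integrable_fin_num.
move: key; rewrite -(fineK Ifin) -(fineK nfin) -!EFinM -EFinD !lee_fin.
move: mV; rewrite /Rintegral; set J := fine _; set I := fine _ => mV key.
have m2a : m = 2 * a by rewrite /a; lra.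
have aI : a `^ p * V <= I.
  have aVJ : a `^ (p - 1) * (m * V) <= a `^ (p - 1) * J.
    by rewrite ler_wpM2l// powR_ge0.
  have : a `^ (p - 1) * (m * V) = 2 * (a `^ p * V).
    by rewrite m2a -(mulr_powRB1 a0 p0); ring.
  lra.
by rewrite m2a powRM// -mulrA ler_wpM2l// powR_ge0.
Qed.

End MeanValues.

(** * Doubling: comparison of volumes and covering of annuli *)

Section VolumeComparison.
Context {R : realType} {M : pmetricType R}.
Variables (mu : {measure set (borel M) -> \bar R}) (o : M).
Hypothesis dbl : doubling mu.
Hypothesis volP : forall (x : M) (r : R), 0 < r -> (0 < volume mu x r < +oo)%E.

Local Notation vol x r := (fine (volume mu x r)).

Lemma volume_fineK x r : 0 < r -> ((vol x r)%:E = volume mu x r)%E.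
Proof.
by move=> /(volP x)/andP[v0 voo]; rewrite fineK// ge0_fin_numE// ltW.
Qed.

Lemma vol_gt0 x r : 0 < r -> 0 < vol x r.
Proof. by move=> r0; rewrite -lte_fin volume_fineK//; case/andP: (volP x r r0). Qed.

Lemma le_vol x y r s : 0 < r -> 0 < s -> ball x r `<=` ball y s ->
  vol x r <= vol y s.
Proof.
move=> r0 s0 xy; rewrite -lee_fin !volume_fineK//; apply: le_measure => //.
all: by rewrite inE; exact: measurable_ball.
Qed.

Lemma vol_compare (A : R) : 0 < A -> exists2 C : R, 0 < C &
  forall x y r s, 0 < r -> 0 < s -> ball x r `<=` ball y (A * s) ->
    vol x r <= C * vol y s.
Proof.
move=> A0; have [C C0 CP] := dbl; set k := (Num.truncn A).+1.
have Ak : A <= 2 ^+ k.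
  apply/ltW/(lt_trans (truncnS_gt A)); rewrite -natrX ltr_nat; exact: ltn_expl.
have iter j y s : 0 < s -> vol y (2 ^+ j * s) <= C ^+ j * vol y s.
  move=> s0; elim: j => [|j IHj]; first by rewrite !expr0 !mul1r.
  have js0 : 0 < 2 ^+ j * s by rewrite mulr_gt0// exprn_gt0.
  rewrite !exprS -!mulrA (@le_trans _ _ (C * vol y (2 ^+ j * s)))//; last first.
    by rewrite ler_pM2l.
  by rewrite -lee_fin EFinM !volume_fineK ?mulr_gt0//; exact: CP.
exists (C ^+ k); first by rewrite exprn_gt0.
move=> x y r s r0 s0 xy; apply: le_trans (iter k y s s0).
apply: le_vol => //; first by rewrite mulr_gt0// exprn_gt0.
apply: (subset_trans xy); apply: le_ball; by rewrite ler_pM2r.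
Qed.

Let sep (d : R) (s : seq M) := pairwise (fun x y => d <= mdist x y) s.

(** A separated set that is not a cover can be enlarged. *)
Let separated_or_cover (A : set M) (d : R) (n : nat) :
  exists s : seq M, (forall x, x \in s -> A x) /\
    ((size s <= n)%N /\ (forall z, A z -> exists2 x, x \in s & ball x d z) \/
     size s = n /\ sep d s).
Proof.
elim: n => [|n [s [sA [[sn scov]|[sn ssep]]]]].
- by exists [::]; split => //; right.
- by exists s; split => //; left; split => //; rewrite leqW.
- have [scov|] := pselect (forall z, A z -> exists2 x, x \in s & ball x d z).
    by exists s; split => //; left; rewrite sn.
  move=> /existsNP[z /not_implyP[Az znot]]; exists (z :: s); split.
    by move=> x; rewrite inE => /predU1P[->//|/sA].
  right; split; first by rewrite /= sn.
  rewrite /sep /=; apply/andP; split => //; apply/allP => x xs.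
  rewrite leNgt; apply/negP => zx.
  by apply: znot; exists x => //; rewrite ballEmdist /= metric_sym.
Qed.

(** The balls of radius [eps * t / 2] around separated points of the annulus are
    disjoint, lie in the ball of radius [2 * Lam * t] around [o], and have by
    doubling a fixed fraction of its volume, which bounds their number. *)
Lemma annulus_cover (Lam eps : R) : 1 <= Lam -> 0 < eps -> eps <= 1 ->
  exists N : nat, forall t, 0 < t -> exists s : seq M,
    [/\ (size s <= N)%N, forall x, x \in s -> t <= mdist x o < Lam * t &
        forall z, t <= mdist z o < Lam * t -> exists2 x, x \in s & ball x (eps * t) z].
Proof.
move=> Lam1 eps0 eps1.
have Lam0 : 0 < Lam by lra.
have A0 : 0 < 6 * Lam / eps by rewrite divr_gt0// mulr_gt0.
have [C C0 CP] := vol_compare _ A0.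
pose N := (Num.truncn C).+1.
exists N => t t0.
have [s [sA [[sn scov]|[sn ssep]]]] :=
  separated_or_cover [set z | t <= mdist z o < Lam * t] (eps * t) N.
  by exists s; split.
exfalso.
have et0 : 0 < eps * t / 2 by rewrite divr_gt0// mulr_gt0.
have L2t0 : 0 < 2 * Lam * t by rewrite !mulr_gt0.
pose V := vol o (2 * Lam * t).
have V0 : 0 < V by exact: vol_gt0.
have small x : t <= mdist x o < Lam * t ->
    ball x (eps * t / 2) `<=` ball o (2 * Lam * t) /\ V <= C * vol x (eps * t / 2).
  move=> /andP[tx xt]; split.
    move=> z; rewrite !ballEmdist/= => xz.
    rewrite (le_lt_trans (metric_triangle _ x _))// [mdist o x]metric_sym.
    have : eps * t / 2 <= Lam * t.
      by rewrite mulrAC ler_pM2r//; lra.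
    by lra.
  apply: CP => // z; rewrite !ballEmdist/= => oz.
  rewrite (le_lt_trans (metric_triangle _ o _))//.
  have -> : 6 * Lam / eps * (eps * t / 2) = 3 * Lam * t by field; rewrite gt_eqF.
  by lra.
have count (u : seq M) : (forall x, x \in u -> t <= mdist x o < Lam * t) ->
    sep (eps * t) u -> exists U : set (borel M), [/\ measurable U,
      forall z, U z -> exists2 x, x \in u & ball x (eps * t / 2) z &
      (((size u)%:R * (V / C))%:E <= mu U)%E].
  elim: u => [_ _|x u IHu xuA /= /andP[/allP xu usep]].
    by exists set0; split => //=; rewrite mul0r.
  have [|U [mU Uu UV]] := IHu _ usep.
    by move=> y yu; apply: xuA; rewrite inE yu orbT.
  have [_ xV] := small x (xuA x (mem_head _ _)).
  exists (U `|` ball x (eps * t / 2)); split.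
  - by apply: measurableU => //; exact: measurable_ball.
  - move=> z [/Uu[y yu yz]|xz]; last by exists x => //; rewrite mem_head.
    by exists y => //; rewrite inE yu orbT.
  - rewrite measureU//; last 2 first.
    + exact: measurable_ball.
    + apply/seteqP; split => // z [/Uu[y /xu xy yz] xz].
      have := metric_triangle x z y; move: xz yz; rewrite !ballEmdist/= => xz yz.
      rewrite [mdist z y]metric_sym; lra.
    + rewrite mulrSr mulrDl mul1r EFinD leeD//.
      apply: (@le_trans _ _ (vol x (eps * t / 2))%:E); last by rewrite volume_fineK.
      rewrite lee_fin.
      by rewrite ler_pdivrMr// mulrC.
have [U [mU Us UV]] := count s sA ssep.
have : (((size s)%:R * (V / C))%:E <= V%:E)%E.
  apply: (le_trans UV); rewrite /V volume_fineK//; apply: le_measure => //.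
  - by rewrite inE.
  - by rewrite inE; exact: measurable_ball.
  - by move=> z /Us[x /sA xA]; have [+ _] := small x xA; exact.
apply/negP; rewrite lee_fin -ltNge mulrA ltr_pdivlMr// mulrC ltr_pM2r// sn.
exact: truncnS_gt.
Qed.

End VolumeComparison.

(** * Decay of local averages from one scale to the next *)

Section Decay.
Context {R : realType} {M : pmetricType R}.
Variables (mu : {measure set (borel M) -> \bar R}) (o : M).
Hypothesis dbl : doubling mu.
Hypothesis volP : forall (x : M) (r : R), 0 < r -> (0 < volume mu x r < +oo)%E.
Variables (P r0 p : R).
Hypotheses (P0 : 0 < P) (p1 : 1 <= p).

Local Notation rho x := (mdist x o).
Local Notation vol x r := (fine (volume mu x r)).
Local Notation avg f x r := (mean mu (ball x r) f).

(** What is used of [f] and of its energy [G E], the integral of the [p]-th power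
    of the gradient norm over [E]: [G] enters only as a monotone and
    superadditive set function that satisfies the Poincare inequality. *)
Definition energy_controls (f : M -> R) (G : set M -> R) : Prop :=
  [/\ measurable_fun [set: borel M] (f : borel M -> R),
      exists b, forall x, `|f x| <= b,
      forall E F, E `<=` F -> 0 <= G E <= G F,
      forall D E F, D `<=` F -> E `<=` F -> D `&` E = set0 -> G D + G E <= G F &
      forall x r, admissible o r0 x r ->
        (\int[mu]_(z in (ball x r : set (borel M)))
           (`|f z - avg f x r| `^ p)%:E <= (P * r `^ p * G (ball x r))%:E)%E].

Let p0 : 0 < p. Proof. exact: lt_le_trans p1. Qed.

(** Replacing a ball by a smaller one costs the ratio of the volumes: the
    deviation of [f] from its mean is integrated over the larger ball. *)
Lemma avg_sub_le (f : M -> R) G x r y s : energy_controls f G ->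
  admissible o r0 x r -> 0 < s -> ball y s `<=` ball x r ->
  `|avg f y s - avg f x r| `^ p * vol y s <= 2 `^ p * (P * r `^ p * G (ball x r)).
Proof.
move=> [mf [b fb] _ _ fP] adm s0 yx.
have := mean_deviation mu p (ball y s) f (avg f x r) b p1 (measurable_ball _ _)
  (volP y s s0) mf fb.
rewrite -[mu (ball y s)]/(volume mu y s) -(volume_fineK mu volP)// -EFinM.
move=> H; rewrite -lee_fin; apply: (le_trans H); rewrite [leRHS]EFinM.
apply: lee_wpmul2l; first by rewrite lee_fin powR_ge0.
apply: le_trans (fP x r adm); apply: ge0_le_lower_integral => // z _;
  by rewrite lee_fin powR_ge0.
Qed.

Lemma ball_integral_le (f : M -> R) G x r : energy_controls f G ->
  admissible o r0 x r ->
  (\int[mu]_(z in (ball x r : set (borel M))) (`|f z| `^ p)%:E <=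
   (2 `^ p * (P * r `^ p * G (ball x r) + `|avg f x r| `^ p * vol x r))%:E)%E.
Proof.
move=> [mf [b fb] _ _ fP] adm; have r_gt0 : 0 < r by case: adm.
apply: (le_trans (integral_powR_split mu p (ball x r) f (avg f x r) (ltW p0)
  (measurable_ball _ _) mf)).
rewrite EFinM; apply: lee_wpmul2l; first by rewrite lee_fin powR_ge0.
rewrite EFinD; apply: leeD; first exact: fP.
by rewrite -[mu (ball x r)]/(volume mu x r) -(volume_fineK mu volP)// -EFinM.
Qed.

Variables (theta Lam nu Crd : R) (N : nat).
Hypotheses (theta01 : 0 < theta < 1) (Lam4 : 4 <= Lam) (Lamtheta : 2 / theta <= Lam).
Hypothesis chain : forall x : M, 1 <= rho x -> exists w : nat -> M,
  [/\ w 0%N = x, rho (w N) = Lam * rho x,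
      forall k, mdist (w k) (w k.+1) <= theta / 4 * rho x &
      forall k, theta * rho x <= rho (w k) <= 3 * Lam * rho x].
Hypothesis rd : forall r r', 0 < r -> r < r' ->
  (r' / r) `^ nu * vol o r <= Crd * vol o r'.
Hypothesis Lamnu : 2 `^ p * Crd * Lam `^ p <= 2^-1 * Lam `^ nu.

Local Notation eps := (theta / 4).

(** The factor [vol o (rho x) / rho x `^ p] is the order of magnitude of the
    integral of [(rho + 1) `^ - p] over a ball around [x] of radius
    [eps * rho x]. *)
Definition scaled_avg (f : M -> R) (x : M) : R :=
  `|avg f x (eps * rho x)| `^ p * vol o (rho x) / rho x `^ p.

Definition shell (t : R) : set M := [set z | t <= Lam * rho z /\ rho z < Lam ^+ 2 * t].

Let theta0 : 0 < theta. Proof. by case/andP: theta01. Qed.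
Let theta1 : theta < 1. Proof. by case/andP: theta01. Qed.
Let Lam0 : 0 < Lam. Proof. exact: lt_le_trans Lam4. Qed.
Let thetaLam : 2 <= theta * Lam.
Proof. by move: Lamtheta; rewrite ler_pdivrMr// mulrC. Qed.
Let Lamsq : 4 * Lam <= Lam ^+ 2.
Proof. by rewrite expr2 ler_pM2r. Qed.

(** The averages along the chain from [x] to [x'] differ from one point to the
    next by at most [2 * eta], and a last change of radius turns [eps * rho x]
    into [eps * rho x'].  The factor 1/2 comes from the choice of [Lam] in terms
    of the reverse doubling exponent. *)
Lemma scaled_avg_decay : exists2 C : R, 0 <= C & forall f G, energy_controls f G ->
  forall x, 1 <= rho x -> exists2 x' : M, rho x' = Lam * rho x &
    scaled_avg f x <= 2^-1 * scaled_avg f x' + C * G (shell (rho x)).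
Proof.
have Lpos := Lam0; have L4 := Lam4.
have L1 : 1 < Lam by lra.
have A0 : 0 < (1 + 3 * Lam) / eps by rewrite !divr_gt0//; lra.
have [Cv Cv0 CvP] := vol_compare mu dbl volP _ A0.
pose Y := Cv * (2 `^ p * (P * (Lam * eps) `^ p)).
have Y0 : 0 <= Y by rewrite !mulr_ge0 ?powR_ge0// ltW.
exists (2 `^ p * ((2 * N + 1)%:R `^ p * Y)).
  by apply: mulr_ge0; [exact: powR_ge0|apply: mulr_ge0 => //; exact: powR_ge0].
move=> f G fG x x1; have [w [w0 wN wd wrho]] := chain x x1.
have [_ _ Gmono _ _] := fG.
have x0 : 0 < rho x by lra.
set delta := eps * rho x in wd *.
have delta0 : 0 < delta by rewrite mulr_gt0// divr_gt0.
have d4 : delta = theta * rho x / 4 by rewrite /delta; ring.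
have tx1 : theta * rho x <= rho x by rewrite ger_pMl// ltW.
have Ltx : 2 * rho x <= Lam * (theta * rho x).
  by rewrite mulrA (mulrC Lam) ler_pM2r.
have L4x : 4 * rho x <= Lam * rho x by rewrite ler_pM2r.
have L2x : 4 * (Lam * rho x) <= Lam ^+ 2 * rho x by rewrite mulrA ler_pM2r.
set g := G (shell (rho x)).
have g0 : 0 <= g by case/andP: (Gmono _ _ (@subset_refl _ (shell (rho x)))).
have V0 : 0 < vol o (rho x) by exact: vol_gt0.
pose eta := (Y * rho x `^ p * g / vol o (rho x)) `^ p^-1.
have eta0 : 0 <= eta by exact: powR_ge0.
have etap : eta `^ p = Y * rho x `^ p * g / vol o (rho x).
  rewrite powRVK//; apply: divr_ge0; rewrite ?(ltW V0)//.
  by apply: mulr_ge0 => //; apply: mulr_ge0 => //; exact: powR_ge0.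
have step k z r : 0 < r -> r <= Lam * delta -> r <= rho z / 2 ->
    ball (w k) delta `<=` ball z r -> ball z r `<=` shell (rho x) ->
    `|avg f (w k) delta - avg f z r| <= eta.
  move=> r_gt0 rL rz wz zs.
  have vw : vol o (rho x) <= Cv * vol (w k) delta.
    apply: CvP => // y; rewrite !ballEmdist/= => oy.
    rewrite (le_lt_trans (metric_triangle _ o _))//.
    have -> : (1 + 3 * Lam) / eps * delta = rho x + 3 * Lam * rho x.
      by rewrite /delta; field; rewrite gt_eqF.
    by have /andP[_] := wrho k; lra.
  have wv0 : 0 < vol (w k) delta by exact: vol_gt0.
  apply: le_of_powR_le => //; rewrite ler_pdivlMr//.
  set e := `|_| `^ p.
  have e0 : 0 <= e by exact: powR_ge0.
  have H : e * vol (w k) delta <= 2 `^ p * (P * r `^ p * G (ball z r)).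
    by apply: avg_sub_le => //; split => //; left.
  apply: (@le_trans _ _ (Cv * (e * vol (w k) delta))).
    by rewrite mulrCA; apply: ler_wpM2l.
  rewrite /Y -!mulrA; apply: ler_wpM2l; first exact: ltW.
  apply: (le_trans H); apply: ler_wpM2l; first exact: powR_ge0.
  rewrite -mulrA; apply: ler_wpM2l; first exact: ltW.
  rewrite mulrA -powRM//; last 2 first.
  - by rewrite mulr_ge0// ?divr_ge0// ltW.
  - exact: ltW.
  have /andP[gz gzg] := Gmono _ _ zs.
  apply: ler_pM => //; first exact: powR_ge0.
  by rewrite -mulrA; apply: ler_powR_base => //; exact: ltW.
have ball2 k : ball (w k) (2 * delta) `<=` shell (rho x).
  move=> z; rewrite ballEmdist /= => wz; have /andP[wk1 wk2] := wrho k.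
  have /ler_normlP[h1 h2] := mdist_lipschitz o (w k) z.
  move: h1 h2; rewrite ![mdist o _]metric_sym => h1 h2.
  have zl : theta * rho x / 2 <= rho z by lra.
  split; last by lra.
  apply: (@le_trans _ _ (Lam * (theta * rho x / 2))); first by lra.
  by rewrite ler_pM2l.
(* Both balls lie in the ball of radius [2 * delta] around [w k]. *)
have hop k : `|avg f (w k) delta - avg f (w k.+1) delta| <= 2 * eta.
  have sub : ball (w k.+1) delta `<=` ball (w k) (2 * delta).
    move=> z; rewrite !ballEmdist/= => wz.
    by rewrite (le_lt_trans (metric_triangle _ (w k.+1) _))//; have := wd k; lra.
  have r1 : 0 < 2 * delta by lra.
  have r2 : 2 * delta <= Lam * delta by rewrite ler_pM2r//; lra.
  have r3 : 2 * delta <= rho (w k) / 2 by have /andP[+ _] := wrho k; lra.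
  have e1 : `|avg f (w k) delta - avg f (w k) (2 * delta)| <= eta.
    by apply: step => //; apply: le_ball; lra.
  have e2 : `|avg f (w k.+1) delta - avg f (w k) (2 * delta)| <= eta.
    exact: step.
  rewrite (le_trans (ler_distD (avg f (w k) (2 * delta)) _ _))//.
  by rewrite [X in _ + X]distrC; lra.
have hops k : `|avg f (w 0%N) delta - avg f (w k) delta| <= (2 * k)%:R * eta.
  elim: k => [|k IHk]; first by rewrite subrr normr0 muln0 mul0r.
  rewrite (le_trans (ler_distD (avg f (w k) delta) _ _))//.
  apply: (le_trans (lerD IHk (hop k))).
  by rewrite -mulrDl ler_wpM2r// mulnS addnC natrD.
have last_hop : `|avg f (w N) delta - avg f (w N) (Lam * delta)| <= eta.
  have Ld : Lam * delta = Lam * (theta * rho x) / 4 by rewrite d4; ring.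
  have Ltx' : Lam * (theta * rho x) <= Lam * rho x by rewrite ler_pM2l.
  apply: step => //.
  - by rewrite mulr_gt0.
  - by rewrite wN Ld; lra.
  - by apply: le_ball; rewrite ler_peMl//; lra.
  - move=> z; rewrite ballEmdist/= Ld => wz.
    have /ler_normlP[h1 h2] := mdist_lipschitz o (w N) z.
    move: h1 h2; rewrite ![mdist o _]metric_sym wN => h1 h2.
    split; last by lra.
    have zl : rho x <= rho z by lra.
    by rewrite (le_trans zl)// ler_peMl ?mdist_ge0//; lra.
have epsL : eps * (Lam * rho x) = Lam * delta by rewrite /delta; ring.
exists (w N) => //; rewrite /scaled_avg wN -/delta epsL -{1}w0.
set m := avg f (w 0%N) delta; set m' := avg f (w N) (Lam * delta).
have mm' : `|m| <= `|m'| + (2 * N + 1)%:R * eta.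
  have h1 := hops N; rewrite -/m in h1.
  have h2 : `|m - m'| <= (2 * N + 1)%:R * eta.
    rewrite (le_trans (ler_distD (avg f (w N) delta) _ _))//.
    by rewrite natrD mulrDl mul1r lerD.
  have := ler_normD (m - m') m'; rewrite subrK; lra.
have mp : `|m| `^ p <= 2 `^ p * (`|m'| `^ p + (2 * N + 1)%:R `^ p * eta `^ p).
  apply: (le_trans (ler_powR_base p _ _ (ltW p0) (normr_ge0 _) mm')).
  apply: (le_trans (powR_add_le p _ _ (ltW p0) _ _)) => //.
    by rewrite mulr_ge0.
  by rewrite [in leLHS]powRM.
have xp0 : 0 < rho x `^ p by exact: powR_gt0.
have Lp0 : 0 < Lam `^ p by exact: powR_gt0.
have Ln0 : 0 < Lam `^ nu by exact: powR_gt0.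
pose v := vol o (rho x); pose v' := vol o (Lam * rho x).
have v'0 : 0 < v' by apply: vol_gt0 => //; rewrite mulr_gt0.
have vv' : Lam `^ nu * v <= Crd * v'.
  have := rd (rho x) (Lam * rho x) x0; rewrite mulfK ?gt_eqF//; apply.
  by rewrite ltr_pMl.
have Crd0 : 0 <= Crd.
  rewrite -(ler_pM2r v'0) mul0r; apply: le_trans vv'.
  by rewrite mulr_ge0 ?ltW.
have vv2 : 2 `^ p * Lam `^ p * v <= 2^-1 * v'.
  rewrite -(ler_pM2l Ln0); apply: (@le_trans _ _ (2 `^ p * Crd * Lam `^ p * v')).
    have -> : Lam `^ nu * (2 `^ p * Lam `^ p * v) =
      2 `^ p * Lam `^ p * (Lam `^ nu * v) by ring.
    have -> : 2 `^ p * Crd * Lam `^ p * v' = 2 `^ p * Lam `^ p * (Crd * v') by ring.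
    by apply: ler_wpM2l => //; rewrite mulr_ge0 ?powR_ge0.
  rewrite mulrA [Lam `^ nu * _]mulrC; apply: ler_wpM2r => //; exact: ltW.
rewrite powRM ?(ltW Lam0) ?(ltW x0)// -/v -/v'.
rewrite ler_pdivrMr// mulrDl.
have -> : 2^-1 * (`|m'| `^ p * v' / (Lam `^ p * rho x `^ p)) * rho x `^ p =
    `|m'| `^ p * (2^-1 * v') / Lam `^ p.
  by field; rewrite !gt_eqF.
have -> : 2 `^ p * ((2 * N + 1)%:R `^ p * Y) * g * rho x `^ p =
    2 `^ p * (2 * N + 1)%:R `^ p * eta `^ p * v.
  by rewrite etap -/v; field; rewrite gt_eqF.
apply: (@le_trans _ _ (2 `^ p * (`|m'| `^ p + (2 * N + 1)%:R `^ p * eta `^ p) * v)).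
  by apply: ler_wpM2r => //; exact: ltW.
rewrite mulrDr mulrDl mulrA lerD2r ler_pdivlMr//.
have -> : 2 `^ p * `|m'| `^ p * v * Lam `^ p =
    `|m'| `^ p * (2 `^ p * Lam `^ p * v) by ring.
by apply: ler_wpM2l => //; exact: powR_ge0.
Qed.

End Decay.

(** * Summation over the scales *)

Section RealSequences.
Context {R : realType}.

(** [T k] stands for the energy outside the [k]-th ball and [g k] for that of a
    band four scales wide: the differences [T k - T (k + 4)] telescope. *)
Lemma sum_band_le (g T : nat -> R) (X : R) (K : nat) :
  (forall k, g k + T (k + 4)%N <= T k) -> (forall k, 0 <= T k <= X) ->
  \sum_(k < K) g k <= 4 * X.
Proof.
move=> gT TX.
suff H : \sum_(k < K) g k + (T K + T K.+1 + T K.+2 + T K.+3) <= 4 * X.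
  have := TX K; have := TX K.+1; have := TX K.+2; have := TX K.+3.
  by move=> /andP[a _] /andP[b _] /andP[c _] /andP[d _]; lra.
elim: K => [|K IHK].
  rewrite big_ord0 add0r; have := TX 0%N; have := TX 1%N; have := TX 2%N; have := TX 3%N.
  by move=> /andP[_ a] /andP[_ b] /andP[_ c] /andP[_ d]; lra.
by rewrite big_ord_recr /=; have := gT K; rewrite addn4; lra.
Qed.

(** The solution of the recursion [s k = s k.+1 / 2 + C * g k] that vanishes at
    [K]: half of the sum is absorbed on the left. *)
Lemma halving_sum (C : R) (g : nat -> R) (K : nat) : 0 <= C -> (forall k, 0 <= g k) ->
  exists s : nat -> R, [/\ s K = 0, forall k, 0 <= s k,
    forall k, (k < K)%N -> s k = 2^-1 * s k.+1 + C * g k &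
    \sum_(k < K) s k <= 2 * C * \sum_(k < K) g k].
Proof.
move=> C0 g0.
(* The extra term [s 0] on the left makes the induction close. *)
suff [s [sK s0 sS ssum]] : exists s : nat -> R, [/\ s K = 0, forall k, 0 <= s k,
    forall k, (k < K)%N -> s k = 2^-1 * s k.+1 + C * g k &
    \sum_(k < K) s k + s 0%N <= 2 * C * \sum_(k < K) g k].
  by exists s; split => //; have := s0 0%N; lra.
elim: K g g0 => [|K IHK] g g0.
  by exists (fun=> 0); split => //; rewrite !big_ord0 mulr0 addr0.
have [s [sK s0 sS ssum]] := IHK (g \o S) (fun k => g0 k.+1).
exists (fun k => if k is k'.+1 then s k' else 2^-1 * s 0%N + C * g 0%N); split => //.
- by case=> // ; rewrite addr_ge0// mulr_ge0.
- by case=> // k kK; exact: sS.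
- rewrite !big_ord_recl /=; move: ssum; rewrite /=; lra.
Qed.

Lemma exists_geometric_scale (Lam y : R) : 2 <= Lam -> 1 <= y ->
  exists k : nat, Lam ^+ k <= y < Lam ^+ k.+1.
Proof.
move=> Lam2 y1.
have pow_ge k : k%:R <= Lam ^+ k.
  apply: (@le_trans _ _ (2 ^+ k)).
    by rewrite -natrX ler_nat ltnW// ltn_expl.
  by apply: lerXn2r => //; rewrite ?nnegrE//; lra.
have ex : exists k, y < Lam ^+ k.
  by exists (Num.truncn y).+1; exact: lt_le_trans (truncnS_gt y) (pow_ge _).
case: (ex_minnP ex) => -[|k] yk kmin; first by move: yk; rewrite expr0; lra.
exists k; rewrite yk andbT leNgt; apply/negP => /kmin; by rewrite ltnn.
Qed.

End RealSequences.

Section IntegralCover.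
Context {d : measure_display} {T : measurableType d} {R : realType}.
Variable mu : {measure set T -> \bar R}.

Lemma integral_le_cover {I : eqType} (h : T -> \bar R) (A : set T)
    (U : I -> set T) (s : seq I) (b : R) :
  measurable_fun setT h -> (forall x, 0 <= h x)%E -> measurable A ->
  (forall i, i \in s -> measurable (U i)) ->
  (forall i, i \in s -> (\int[mu]_(x in U i) h x <= b%:E)%E) ->
  (forall x, A x -> exists2 i, i \in s & U i x) ->
  (\int[mu]_(x in A) h x <= ((size s)%:R * b)%:E)%E.
Proof.
move=> mh h0; elim: s A => [|i s IHs] A mA mU Ub Acov.
  have -> : A = set0 by apply/seteqP; split => // x /Acov[].
  by rewrite integral_set0 mul0r.
have mUi : measurable (U i) by apply: mU; rewrite mem_head.
have -> : A = (A `&` U i) `|` (A `\` U i) by rewrite setUIDK.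
rewrite ge0_integral_setU//; last 4 first.
- exact: measurableI.
- exact: measurableD.
- exact: measurable_funTS.
- rewrite disj_set2E; apply/eqP/seteqP; split => // x [[_ a] [_ b']]; exact: b'.
rewrite /= mulrS mulrDl mul1r EFinD; apply: leeD.
- apply: le_trans (Ub i (mem_head _ _)).
  by apply: ge0_le_lower_integral => // x [].
- apply: IHs.
  + exact: measurableD.
  + by move=> j js; apply: mU; rewrite inE js orbT.
  + by move=> j js; apply: Ub; rewrite inE js orbT.
  + move=> x [/Acov[j + Ujx] Uix]; rewrite inE => /predU1P[ji|js]; last by exists j.
    by case: Uix; rewrite -ji.
Qed.

End IntegralCover.

Section Summation.
Context {R : realType} {M : pmetricType R}.
Variables (mu : {measure set (borel M) -> \bar R}) (o : M).
Hypothesis dbl : doubling mu.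
Hypothesis volP : forall (x : M) (r : R), 0 < r -> (0 < volume mu x r < +oo)%E.
Variables (P r0 p theta Lam C1 : R).
Hypotheses (P0 : 0 < P) (p1 : 1 <= p) (theta01 : 0 < theta < 1) (Lam4 : 4 <= Lam).

Local Notation rho x := (mdist x o).
Local Notation vol x r := (fine (volume mu x r)).
Local Notation avg f x r := (mean mu (ball x r) f).
Local Notation eps := (theta / 4).
Local Notation controls := (energy_controls mu o P r0 p).
Local Notation scaled := (scaled_avg mu o p theta).

Hypothesis C1ge0 : 0 <= C1.
Hypothesis decay : forall f G, controls f G ->
  forall x, 1 <= rho x -> exists2 x' : M, rho x' = Lam * rho x &
    scaled f x <= 2^-1 * scaled f x' + C1 * G (shell o Lam (rho x)).

Definition hardy_density (f : M -> R) (x : borel M) : \bar R :=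
  ((`|f x| / (mdist (x : M) o + 1)) `^ p)%:E.

Definition band (t : R) : set M := [set z | t <= Lam * rho z /\ rho z < Lam ^+ 3 * t].

Let p0 : 0 < p. Proof. exact: lt_le_trans p1. Qed.
Let theta0 : 0 < theta. Proof. by case/andP: theta01. Qed.
Let theta1 : theta < 1. Proof. by case/andP: theta01. Qed.
Let Lam0 : 0 < Lam. Proof. exact: lt_le_trans Lam4. Qed.

Let hardy_density_ge0 f x : (0 <= hardy_density f x)%E.
Proof. by rewrite lee_fin powR_ge0. Qed.

Lemma measurable_continuous_borel (f : M -> R) : continuous f ->
  measurable_fun [set: borel M] (f : borel M -> R).
Proof.
move=> /continuousP cf; apply: (measurability _ (RGenOpens.measurableE R)).
move=> _ [_ [a [b ->] <-]]; rewrite setTI; apply: sub_sigma_algebra.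
exact/cf/interval_open.
Qed.

Lemma continuous_rho : continuous (fun x : M => rho x).
Proof.
have -> : (fun x : M => rho x) = mdist o by apply/funext => x; exact: metric_sym.
exact: continuous_mdist.
Qed.

Lemma measurable_hardy_density f G : controls f G ->
  measurable_fun [set: borel M] (hardy_density f).
Proof.
move=> [mf _ _ _ _]; apply/measurable_EFinP.
apply: (measurableT_comp (measurable_powR p)).
apply: measurable_funM; first exact: measurableT_comp.
apply: (measurable_continuous_borel (fun x => (rho x + 1)^-1)) => x.
apply: (@continuousV R M (fun x => rho x + 1)).
  by rewrite gt_eqF// ltr_wpDl// mdist_ge0.
by apply: (@continuousD R R M); [exact: continuous_rho|exact: cst_continuous].
Qed.

Let scaled_ge0 f x : 0 <= scaled f x.
Proof. by rewrite /scaled_avg divr_ge0 ?powR_ge0// mulr_ge0 ?powR_ge0// fine_ge0. Qed.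

(** The annulus is covered by a bounded number of balls of radius [eps * rho x];
    on each of them [rho] is comparable to [t], and the integral of [|f| `^ p]
    splits into the deviation from the mean and the mean itself. *)
Lemma annulus_integral_le : exists2 C : R, 0 <= C & forall f G, controls f G ->
  forall t s, 0 < t -> 0 <= s ->
  (forall x, t <= rho x < Lam * t -> scaled f x <= s) ->
  (\int[mu]_(x in (ball o (Lam * t) `\` ball o t)) hardy_density f x <=
    (C * (G (band t) + s))%:E)%E.
Proof.
have Lpos := Lam0; have L4 := Lam4; have th0 := theta0; have th1 := theta1.
have eps0 : 0 < eps by rewrite divr_gt0.
have eps1 : eps <= 1 by lra.
have Lam1 : 1 <= Lam by lra.
have [N NP] := annulus_cover mu o dbl volP Lam eps Lam1 eps0 eps1.
have [Cv Cv0 CvP] := vol_compare mu dbl volP 2 (ltr0n _ 2).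
pose b := (4 * Lam) `^ p * (P * eps `^ p + Cv).
have b0 : 0 <= b.
  by apply: mulr_ge0; rewrite ?powR_ge0// addr_ge0 ?(ltW Cv0)// mulr_ge0 ?powR_ge0// ltW.
exists (N%:R * b); first by rewrite mulr_ge0.
move=> f G fG t s t0 s0 fs; have [u [uN ut ucov]] := NP t t0.
have [mf _ Gmono _ _] := fG.
have g0 : 0 <= G (band t) by case/andP: (Gmono _ _ (@subset_refl _ (band t))).
apply: (@le_trans _ _ ((size u)%:R * (b * (G (band t) + s)))%:E); last first.
  rewrite lee_fin mulrA; apply: ler_wpM2r; first exact: addr_ge0.
  by apply: ler_wpM2r => //; rewrite ler_nat.
apply: (integral_le_cover _ _ _ (fun x => ball x (eps * rho x) : set (borel M))).
- exact: measurable_hardy_density fG.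
- exact: hardy_density_ge0.
- by apply: measurableD; exact: measurable_ball.
- by move=> x _; exact: measurable_ball.
- move=> x /ut /[dup] tx /andP[tx1 tx2].
  have x0 : 0 < rho x by lra.
  have er : eps * rho x <= rho x / 4 by rewrite mulrAC ler_pM2r// ger_pMl// ltW.
  have adm : admissible o r0 x (eps * rho x).
    by split; [rewrite mulr_gt0|left; lra].
  have near z : ball x (eps * rho x) z -> rho x / 2 <= rho z <= 2 * rho x.
    rewrite ballEmdist /= => xz.
    have /ler_normlP[h1 h2] := mdist_lipschitz o x z.
    by move: h1 h2; rewrite ![mdist o _]metric_sym => h1 h2; apply/andP; split; lra.
  apply: (@le_trans _ _ (((2 / t) `^ p)%:E *
      \int[mu]_(z in (ball x (eps * rho x) : set (borel M))) (`|f z| `^ p)%:E)%E).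
    have mfp : measurable_fun (ball x (eps * rho x) : set (borel M))
        ((fun z => (`|f z| `^ p)%:E) : borel M -> \bar R).
      apply/measurable_EFinP; apply: measurable_funTS.
      apply: (measurableT_comp (measurable_powR p)); exact: measurableT_comp.
    rewrite -ge0_integralZl//; last 2 first.
    + exact: measurable_ball.
    + by rewrite lee_fin powR_ge0.
    apply: ge0_le_lower_integral => // z xz.
      by rewrite -EFinM lee_fin mulr_ge0 ?powR_ge0.
    rewrite -EFinM lee_fin -powRM//; last by rewrite divr_ge0// ltW.
    apply: ler_powR_base; rewrite ?(ltW p0)//.
      by rewrite divr_ge0// addr_ge0// mdist_ge0.
    rewrite mulrC; apply: ler_wpM2r => //.
    have /andP[z1 _] := near z xz.
    rewrite -[2 / t]invf_div lef_pV2 ?posrE ?divr_gt0//; last by lra.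
    by lra.
  apply: (@le_trans _ _ (((2 / t) `^ p)%:E *
      (2 `^ p * (P * (eps * rho x) `^ p * G (band t) +
        Cv * (scaled f x * rho x `^ p)))%:E)%E).
    apply: lee_wpmul2l; first by rewrite lee_fin powR_ge0.
    apply: (le_trans (ball_integral_le mu o volP P r0 p p1 f G x _ fG adm)).
    rewrite lee_fin; apply: ler_wpM2l; first exact: powR_ge0.
    apply: lerD.
      apply: ler_wpM2l; first by rewrite mulr_ge0 ?powR_ge0// ltW.
      have xb : ball x (eps * rho x) `<=` band t.
        move=> z /near /andP[z1 z2]; split.
          apply: (@le_trans _ _ (2 * rho z)); first by lra.
          by apply: ler_wpM2r; [exact: mdist_ge0|lra].
        apply: (le_lt_trans z2); rewrite exprS expr2 -mulrA.
        have : 16 * (Lam * t) <= Lam ^+ 2 * (Lam * t).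
          rewrite ler_pM2r ?mulr_gt0// (_ : 16 = 4 ^+ 2 :> R); last by ring.
          by rewrite lerXn2r// nnegrE//; lra.
        by rewrite expr2; lra.
      by case/andP: (Gmono _ _ xb).
    rewrite /scaled_avg mulfVK ?gt_eqF ?powR_gt0// [leRHS]mulrCA.
    apply: ler_wpM2l; first exact: powR_ge0.
    apply: CvP => //; first by rewrite mulr_gt0.
    move=> z; rewrite !ballEmdist/= => xz.
    rewrite (le_lt_trans (metric_triangle _ x _))//.
    by rewrite [mdist o x]metric_sym; lra.
  rewrite -EFinM lee_fin.
  have xLt : rho x `^ p <= (Lam * t) `^ p.
    by apply: ler_powR_base; rewrite ?(ltW p0)// ltW.
  have -> : b * (G (band t) + s) =
      (2 / t) `^ p * (2 `^ p * ((P * eps `^ p + Cv) * (Lam * t) `^ p * (G (band t) + s))).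
    rewrite mulrA -powRM ?divr_ge0// ?(ltW t0)//.
    have -> : 2 / t * 2 = 4 / t by ring.
    have -> : (4 / t) `^ p * ((P * eps `^ p + Cv) * (Lam * t) `^ p * (G (band t) + s)) =
      ((4 / t) `^ p * (Lam * t) `^ p) * (P * eps `^ p + Cv) * (G (band t) + s) by ring.
    rewrite -powRM ?divr_ge0 ?mulr_ge0 ?(ltW t0) ?(ltW Lpos)//.
    by rewrite (_ : 4 / t * (Lam * t) = 4 * Lam)//; field; rewrite gt_eqF.
  apply: ler_wpM2l; first exact: powR_ge0.
  apply: ler_wpM2l; first exact: powR_ge0.
  rewrite powRM ?(ltW eps0) ?(ltW x0)//.
  have xp := powR_ge0 (rho x) p; have ep := powR_ge0 eps p.
  have c1 : P * (eps `^ p * rho x `^ p) * G (band t) <=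
      P * eps `^ p * (Lam * t) `^ p * (G (band t) + s).
    rewrite mulrA; apply: ler_pM; rewrite ?lerDl//.
    + by rewrite !mulr_ge0// ltW.
    + by apply: ler_wpM2l => //; rewrite mulr_ge0// ltW.
  have c2 : Cv * (scaled f x * rho x `^ p) <= Cv * (Lam * t) `^ p * (G (band t) + s).
    rewrite -mulrA; apply: ler_wpM2l; first exact: ltW.
    rewrite mulrC; apply: ler_pM => //.
    by rewrite (le_trans (fs x tx))// lerDr.
  by rewrite !mulrDl; lra.
- move=> z [zt1 zt2].
  have [|x xu xz] := ucov z.
    move: zt1 zt2; rewrite !ballEmdist/= metric_sym => -> /negP.
    by rewrite -leNgt => ->.
  exists x => //; apply: le_ball xz; rewrite ler_pM2l//.
  by case/andP: (ut x xu).
Qed.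

(** The unit ball is contained in the anchored ball of radius [r0], and so is the
    remote ball around [x0]; Poincare on the anchored ball compares the two
    averages. *)
Lemma unit_ball_integral_le (x0 : M) : 1 <= rho x0 -> 2 * rho x0 <= r0 ->
  exists2 C : R, 0 <= C & forall f G, controls f G ->
    (\int[mu]_(x in (ball o 1 : set (borel M))) hardy_density f x <=
      (C * (G [set: M] + scaled f x0))%:E)%E.
Proof.
move=> x01 x0r; have th0 := theta0; have th1 := theta1.
have eps0 : 0 < eps by rewrite divr_gt0.
have er : eps * rho x0 <= rho x0 / 4 by rewrite mulrAC ler_pM2r// ger_pMl ?ltW//; lra.
have r0_gt0 : 0 < r0 by lra.
have x0_gt0 : 0 < rho x0 by lra.
have ex0 : 0 < eps * rho x0 by rewrite mulr_gt0.
pose v := vol x0 (eps * rho x0); pose w := vol o (rho x0); pose V := vol o r0.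
have v0 : 0 < v by exact: vol_gt0.
have w0 : 0 < w by exact: vol_gt0.
have V0 : 0 < V by exact: vol_gt0.
pose Q := P * r0 `^ p.
have Q0 : 0 <= Q by rewrite mulr_ge0 ?powR_ge0// ltW.
pose A := 2 `^ p * (2 `^ p * Q / v) * V.
have A0 : 0 <= A.
  apply: mulr_ge0; last exact: ltW.
  apply: mulr_ge0; first exact: powR_ge0.
  by apply: divr_ge0; [apply: mulr_ge0 => //; exact: powR_ge0|exact: ltW].
pose B := 2 `^ p * (rho x0 `^ p / w) * V.
have B0 : 0 <= B.
  apply: mulr_ge0; last exact: ltW.
  apply: mulr_ge0; first exact: powR_ge0.
  by apply: divr_ge0; [exact: powR_ge0|exact: ltW].
exists (2 `^ p * (Q + A + B)).
  by rewrite mulr_ge0 ?powR_ge0// !addr_ge0.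
move=> f G fG; have [mf _ Gmono _ _] := fG.
have adm : admissible o r0 o r0 by split => //; right.
have GB : 0 <= G (ball o r0) <= G [set: M] by exact: Gmono.
have /andP[GB0 GBT] := GB.
have sub : ball x0 (eps * rho x0) `<=` ball o r0.
  move=> z; rewrite !ballEmdist/= => xz.
  rewrite (le_lt_trans (metric_triangle _ x0 _))//.
  by rewrite [mdist o x0]metric_sym; lra.
apply: (@le_trans _ _ (\int[mu]_(z in (ball o r0 : set (borel M))) (`|f z| `^ p)%:E)%E).
  apply: ge0_le_lower_integral => [|z _|z _|z _].
  - by apply: le_ball; lra.
  - exact: hardy_density_ge0.
  - by rewrite lee_fin powR_ge0.
  - rewrite lee_fin; apply: ler_powR_base; rewrite ?(ltW p0)//.
      by rewrite divr_ge0// addr_ge0// mdist_ge0.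
    by rewrite ler_pdivrMr ?ltr_wpDl ?mdist_ge0// ler_peMr// lerDr mdist_ge0.
apply: (le_trans (ball_integral_le mu o volP P r0 p p1 f G o r0 fG adm)).
rewrite lee_fin -/Q -/V -mulrA; apply: ler_wpM2l; first exact: powR_ge0.
have := avg_sub_le mu o volP P r0 p p1 f G o r0 x0 _ fG adm ex0 sub.
rewrite -/Q -/v; set m := avg f o r0; set m' := avg f x0 _ => mm.
have mle : `|m| `^ p <= 2 `^ p * (`|m'| `^ p + `|m' - m| `^ p).
  apply: le_trans (powR_add_le _ _ _ (ltW p0) (normr_ge0 _) (normr_ge0 _)).
  apply: ler_powR_base; rewrite ?(ltW p0)//.
  by have := ler_normB m' (m' - m); rewrite subKr.
have sc : `|m'| `^ p = rho x0 `^ p / w * scaled f x0.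
  by rewrite /scaled_avg -/m' -/w; field; rewrite !gt_eqF// powR_gt0.
have dif : `|m' - m| `^ p <= 2 `^ p * Q / v * G [set: M].
  rewrite mulrAC ler_pdivlMr//; apply: (le_trans mm).
  rewrite -[leRHS]mulrA; apply: ler_wpM2l; first exact: powR_ge0.
  exact: ler_wpM2l.
have s0 := scaled_ge0 f x0.
have mV : `|m| `^ p * V <= A * G [set: M] + B * scaled f x0.
  have -> : A * G [set: M] + B * scaled f x0 = 2 `^ p *
      (rho x0 `^ p / w * scaled f x0 + 2 `^ p * Q / v * G [set: M]) * V.
    by rewrite /A /B; ring.
  apply: ler_wpM2r; first exact: ltW.
  apply: (le_trans mle); apply: ler_wpM2l; first exact: powR_ge0.
  by rewrite sc lerD2l.
have GT0 : 0 <= G [set: M] by exact: le_trans GBT.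
have q1 : Q * G (ball o r0) <= Q * G [set: M] by exact: ler_wpM2l.
have q2 : 0 <= Q * scaled f x0 by exact: mulr_ge0.
have q3 : 0 <= A * scaled f x0 by exact: mulr_ge0.
have q4 : 0 <= B * G [set: M] by exact: mulr_ge0.
apply: (le_trans (lerD q1 mV)); rewrite -subr_ge0.
have -> : (Q + A + B) * (G [set: M] + scaled f x0) -
    (Q * G [set: M] + (A * G [set: M] + B * scaled f x0)) =
    A * scaled f x0 + B * G [set: M] + Q * scaled f x0 by ring.
by apply: addr_ge0 => //; exact: addr_ge0.
Qed.

(** The scales run up to a [K] such that [f] vanishes at distance [Lam ^+ K / 2]
    and beyond, so that the averages on the [K]-th annulus are zero and the decay
    can be iterated downwards from [K]. *)
Lemma hardy_of_decay (x0 : M) : 1 <= rho x0 -> 2 * rho x0 <= r0 ->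
  exists2 C : R, 0 < C & forall f G, controls f G ->
    (exists a, forall x, a <= rho x -> f x = 0) ->
    (\int[mu]_x hardy_density f x <= (C * G [set: M])%:E)%E.
Proof.
move=> x01 x0r; have L4 := Lam4; have Lpos := Lam0.
have [Cin Cin0 CinP] := unit_ball_integral_le x0 x01 x0r.
have [Can Can0 CanP] := annulus_integral_le.
exists (Cin * (1 + 8 * C1) + Can * (4 + 8 * C1) + 1).
  by rewrite ltr_wpDl// addr_ge0// mulr_ge0// addr_ge0// mulr_ge0.
move=> f G fG [a fa]; have [mf _ Gmono Gadd _] := fG.
have L1 : 1 < Lam by lra.
have pow_gt0 k : 0 < Lam ^+ k by exact: exprn_gt0.
have pow_ge1 k : 1 <= Lam ^+ k by rewrite exprn_ege1// ltW.
have pow_mono i j : (i <= j)%N -> Lam ^+ i <= Lam ^+ j.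
  by move=> ij; rewrite ler_eXn2l.
have L2 : 2 <= Lam by lra.
have [k0 k0P] := exists_geometric_scale Lam (rho x0) L2 x01.
have [K [k0K aK]] : exists K, (k0 < K)%N /\ 2 * a <= Lam ^+ K.
  have max1 : 1 <= Num.max 1 (2 * a) by rewrite le_max lexx.
  have [k1 /andP[_ k1P]] := exists_geometric_scale Lam _ L2 max1.
  exists (maxn k0.+1 k1.+1); split; first exact: leq_maxl.
  apply: (@le_trans _ _ (Lam ^+ k1.+1)); last exact/pow_mono/leq_maxr.
  by apply: ltW; apply: le_lt_trans k1P; rewrite le_max lexx orbT.
pose g k := G (band (Lam ^+ k)).
pose T k := G [set z | Lam ^+ k <= Lam * rho z].
have g0 k : 0 <= g k by case/andP: (Gmono _ _ (@subset_refl _ (band (Lam ^+ k)))).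
have gsum : \sum_(k < K) g k <= 4 * G [set: M].
  apply: (sum_band_le _ T) => k; last exact: Gmono.
  apply: Gadd.
  - by move=> z [].
  - by move=> z /=; apply: le_trans; exact/pow_mono/leq_addr.
  - apply/seteqP; split => // z [[_]] /=; rewrite -exprD addnC addn3 addn4 exprS.
    by rewrite ler_pM2l// leNgt => ->.
have [s [sK s0 sS ssum]] := halving_sum C1 g K C1ge0 g0.
have G0 : 0 <= G [set: M] by case/andP: (Gmono _ _ (@subset_refl _ [set: M])).
have ssum8 : \sum_(k < K) s k <= 8 * C1 * G [set: M].
  apply: (le_trans ssum); rewrite (_ : 8 * C1 * _ = 2 * C1 * (4 * G [set: M])).
    by apply: ler_wpM2l => //; rewrite mulr_ge0.
  by ring.
(* [s (K - j)] bounds the scaled averages on the annulus at scale [K - j]. *)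
have scaled_le j : (j <= K)%N -> forall x,
    Lam ^+ (K - j) <= rho x < Lam * Lam ^+ (K - j) -> scaled f x <= s (K - j)%N.
  elim: j => [_ x|j IHj jK x /andP[xl xu]].
    rewrite subn0 sK => /andP[xK _].
    rewrite /scaled_avg /mean (_ : Rintegral _ _ _ = 0).
      by rewrite mulr0 normr0 powR0 ?gt_eqF// !mul0r.
    rewrite (@eq_Rintegral _ _ _ _ _ (cst 0)).
      by rewrite Rintegral_cst ?mul0r//; exact: measurable_ball.
    move=> z /set_mem; rewrite ballEmdist /= => xz; apply: fa.
    have x_gt0 : 0 < rho x by rewrite (lt_le_trans _ xK).
    have er : eps * rho x <= rho x / 4.
      by rewrite mulrAC ler_pM2r// ger_pMl// ltW.
    have /ler_normlP[h1 h2] := mdist_lipschitz o x z.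
    by move: h1 h2; rewrite ![mdist o _]metric_sym => h1 h2; lra.
  have kE : (K - j = (K - j.+1).+1)%N by rewrite subnSK.
  have kK : (K - j.+1 < K)%N by rewrite -kE leq_subr.
  set k := (K - j.+1)%N in xl xu kE kK *.
  have [|x' x'E dec] := decay f G fG x; first exact: le_trans xl.
  rewrite (sS k kK); apply: (le_trans dec); apply: lerD.
    apply: ler_wpM2l => //; rewrite -kE; apply: IHj; first exact: ltnW.
    by rewrite kE exprS x'E ler_pM2l// ltr_pM2l// xl.
  apply: ler_wpM2l => //.
  suff : shell o Lam (rho x) `<=` band (Lam ^+ k) by move=> /Gmono /andP[].
  move=> z [zl zu]; split; first exact: le_trans zl.
  apply: (lt_le_trans zu); rewrite [Lam ^+ 3]exprSr -[leRHS]mulrA ler_pM2l ?exprn_gt0//.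
  exact: ltW.
have balls k : (k <= K)%N ->
    (\int[mu]_(x in (ball o (Lam ^+ k) : set (borel M))) hardy_density f x <=
      (Cin * (G [set: M] + scaled f x0) + Can * (\sum_(j < k) (g j + s j)))%:E)%E.
  elim: k => [_|k IHk kK].
    by rewrite big_ord0 mulr0 addr0 expr0; exact: CinP.
  have sub : ball o (Lam ^+ k) `<=` ball o (Lam ^+ k.+1).
    by apply: le_ball; exact: pow_mono.
  rewrite -(setDUK sub) ge0_integral_setU//; last 4 first.
  - exact: measurable_ball.
  - by apply: measurableD; exact: measurable_ball.
  - by apply: measurable_funTS; exact: measurable_hardy_density fG.
  - by rewrite disj_set2E setDIK.
  rewrite big_ord_recr /= [Can * _]mulrDr [X in (_ <= X%:E)%E]addrA EFinD.
  apply: leeD; first exact: (IHk (ltnW kK)).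
  rewrite exprS; apply: (CanP f G fG) => //.
  move=> x xk; have := scaled_le (K - k)%N (leq_subr _ _) x.
  by rewrite subKn ?(ltnW kK)//; exact.
have x0s : scaled f x0 <= 8 * C1 * G [set: M].
  apply: le_trans ssum8; apply: (@le_trans _ _ (s k0)).
    have := scaled_le (K - k0)%N (leq_subr _ _) x0.
    by rewrite subKn ?(ltnW k0K)// -exprS; exact.
  by rewrite (bigD1 (Ordinal k0K))//= lerDl sumr_ge0.
have -> : (\int[mu]_x hardy_density f x =
    \int[mu]_(x in (ball o (Lam ^+ K) : set (borel M))) hardy_density f x)%E.
  rewrite [RHS]integral_mkcond; apply: eq_integral => x _; rewrite patchE.
  case: ifPn => // /negP xK; rewrite /hardy_density fa ?normr0 ?mul0r ?powR0 ?gt_eqF//.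
  have : ~ (ball o (Lam ^+ K) x) by move=> h; apply: xK; exact/mem_set.
  rewrite ballEmdist /= metric_sym => /negP; rewrite -leNgt => xK'.
  have := pow_gt0 K; have [a0|a0] := leP 0 a; lra.
apply: (le_trans (balls K (leqnn K))); rewrite lee_fin big_split /=.
have h1 : Cin * (G [set: M] + scaled f x0) <= Cin * ((1 + 8 * C1) * G [set: M]).
  by apply: ler_wpM2l => //; rewrite mulrDl mul1r lerD2l.
have h2 : Can * (\sum_(i < K) g i + \sum_(i < K) s i) <=
    Can * ((4 + 8 * C1) * G [set: M]).
  by apply: ler_wpM2l => //; rewrite mulrDl; exact: lerD.
by rewrite !mulrDl mul1r -[Cin * _ * _]mulrA -[Can * _ * _]mulrA; lra.
Qed.

End Summation.

(** * Smooth functions, and the measure of balls *)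

Section SmoothFunctions.
Context {R : realType} {n : nat} {M : pmetricType R}.
Variables (S : riemannian_structure n M) (mu : {measure set (borel M) -> \bar R}).

Lemma Ck_on_subset {V : normedModType R} k (U U' : set 'rV[R]_n) (f : 'rV[R]_n -> V) :
  U' `<=` U -> Ck_on k U f -> Ck_on k U' f.
Proof.
move=> UU'; elim: k f => [|k IHk] f /=; first by move=> Uf y /UU'; exact: Uf.
by move=> [df Df]; split => [y /UU'|v]; [exact: df|exact: IHk].
Qed.

Lemma smooth_on_subset (U U' : set M) f : U' `<=` U -> smooth_on S U f ->
  smooth_on S U' f.
Proof.
move=> UU' fS i k; apply: Ck_on_subset (fS i k) => y [x [xi xU'] <-].
by exists x => //; split => //; exact: UU'.
Qed.

Lemma smooth_continuous f : smooth_on S [set: M] f -> continuous f.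
Proof.
move=> fS x; pose i := chart_at S x.
have xi : dom i x by exact: dom_chart_at.
have yi : (coord_map i @` (dom i `&` [set: M])) (coord_map i x) by exists x.
have fp := fS i 0%N _ yi; have ci := coord_map_continuous xi.
have fc : f (param i (coord_map i z)) @[z --> x] --> f x.
  rewrite -[X in _ --> f X](coord_mapK xi).
  exact: (@continuous_comp M _ _ (coord_map i) (f \o param i : _ -> R^o)).
apply: cvg_trans fc; apply: near_eq_cvg; near=> z.
rewrite /= coord_mapK//; near: z.
by apply: open_nbhs_nbhs; split => //; exact: open_dom.
Unshelve. all: by end_near. Qed.

Lemma compact_support_bounded (f g : M -> R) :
  continuous g -> compact (closure [set x | f x != 0]) ->
  exists b, forall x, f x != 0 -> `|g x| <= b.
Proof.
move=> gc fK.
have /compact_bounded[b [_ bP]] : compact (g @` closure [set x | f x != 0]).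
  by apply: continuous_compact => //; exact: continuous_subspaceT.
exists (b + 1) => x fx; apply: (bP (b + 1)); first by rewrite ltrDl.
by exists x => //; exact: subset_closure.
Qed.

Lemma Lp_normE (p : R) (B : set M) (g : M -> R) : 0 < p ->
  Lp_norm mu p B g =
  ((\int[mu]_(x in (B : set (borel M))) (`|g x| `^ p)%:E) `^ p^-1)%E.
Proof.
move=> p0; rewrite /Lp_norm Lnorm.unlock; congr (_ `^ _)%E.
rewrite [RHS]integral_mkcond; apply: eq_integral => x _; rewrite /= !patchE.
case: ifP => // _; have -> : (point : R) = 0 by [].
by rewrite normr0 powR0 ?gt_eqF.
Qed.

End SmoothFunctions.

Section MeasureOfBalls.
Context {R : realType} {M : pmetricType R}.
Variables (mu : {measure set (borel M) -> \bar R}) (o : M).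
Hypothesis dbl : doubling mu.

Lemma exists_pow2_ge (a b : R) : 0 < b -> exists k : nat, a <= 2 ^+ k * b.
Proof.
move=> b0; exists (Num.truncn (a / b)).+1; rewrite -ler_pdivrMr//.
apply/ltW/(lt_trans (truncnS_gt _)); rewrite -natrX ltr_nat; exact: ltn_expl.
Qed.

Lemma le_volume x y r s : ball x r `<=` ball y s ->
  (volume mu x r <= volume mu y s)%E.
Proof. by move=> xy; apply: le_measure => //; rewrite inE; exact: measurable_ball. Qed.

Lemma ball_subset_at (x y : M) (r : R) : ball x r `<=` ball y (mdist y x + r).
Proof.
move=> z; rewrite !ballEmdist /= => xz.
by rewrite (le_lt_trans (metric_triangle _ x _))// ltrD2l.
Qed.

Lemma volume_lty x0 r1 : 0 < r1 -> (volume mu x0 r1 < +oo)%E ->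
  forall x r, (volume mu x r < +oo)%E.
Proof.
move=> r10 v1 x r; have [C C0 CP] := dbl.
have fin k : (volume mu x0 (2 ^+ k * r1) < +oo)%E.
  elim: k => [|k IHk]; first by rewrite expr0 mul1r.
  rewrite exprS -mulrA; apply: le_lt_trans (CP x0 _ _) _.
    by rewrite mulr_gt0// exprn_gt0.
  by rewrite lte_mul_pinfty// lee_fin ltW.
have [k kP] := exists_pow2_ge (mdist x0 x + r) r1 r10.
apply: le_lt_trans (fin k); apply: le_volume.
by apply: subset_trans (le_ball kP); exact: ball_subset_at.
Qed.

Lemma null_measure_of_null_ball x0 r1 : 0 < r1 -> volume mu x0 r1 = 0%E ->
  mu [set: borel M] = 0%E.
Proof.
move=> r10 v1; have [C C0 CP] := dbl.
have null k : volume mu x0 (2 ^+ k * r1) = 0%E.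
  elim: k => [|k IHk]; first by rewrite expr0 mul1r.
  apply/eqP; rewrite eq_le measure_ge0 andbT exprS -mulrA.
  have /CP /le_trans := mulr_gt0 (exprn_gt0 k (ltr0n R 2)) r10.
  by move=> /(_ x0 0%E); apply; rewrite IHk mule0.
have -> : [set: borel M] = \bigcup_k (ball x0 (2 ^+ k * r1) : set (borel M)).
  apply/seteqP; split => // x _; have [k kP] := exists_pow2_ge (mdist x0 x + 1) r1 r10.
  by exists k => //; rewrite ballEmdist /=; apply: lt_le_trans kP; rewrite ltrDl.
apply/eqP; rewrite eq_le measure_ge0 andbT.
apply: (le_trans (measure_sigma_subadditive _ _ _ (@subset_refl _ _))) => //.
- by move=> k; exact: measurable_ball.
- by apply: bigcupT_measurable => k; exact: measurable_ball.
- rewrite eseries0// => k _ _; exact: null.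
Qed.

Lemma volume_gt0 : (forall r, 0 < r -> (0 < volume mu o r)%E) ->
  forall x r, 0 < r -> (0 < volume mu x r)%E.
Proof.
move=> v0 x r r_gt0; rewrite lt_neqAle measure_ge0 andbT eq_sym; apply/eqP => xr.
have := v0 1 ltr01.
have mu0 := null_measure_of_null_ball x r r_gt0 xr.
suff -> : volume mu o 1 = 0%E by rewrite ltxx.
apply/eqP; rewrite eq_le measure_ge0 andbT -mu0; apply: le_measure => //;
  rewrite inE //; exact: measurable_ball.
Qed.

End MeasureOfBalls.

(** If all points were at distance less than 1 from [o], the volume of the balls
    around [o] would be constant from radius 1 on, whereas reverse doubling makes
    it unbounded. *)
Lemma unbounded_of_reverse_doubling {R : realType} {M : pmetricType R}
    (mu : {measure set (borel M) -> \bar R}) (o : M) (nu : R) :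
  (forall x r, 0 < r -> (0 < volume mu x r < +oo)%E) ->
  1 < nu -> reverse_doubling mu nu -> exists x, 1 <= mdist x o.
Proof.
move=> volP nu1 [C C0 rd]; apply: contrapT => nex.
have all1 s : 1 <= s -> volume mu o s = volume mu o 1.
  move=> s1; congr (mu _); apply/seteqP; split; last exact: le_ball.
  move=> x _; rewrite ballEmdist /= metric_sym ltNge; apply/negP => x1.
  by apply: nex; exists x.
have := rd o 1 (C + 2) ltr01; rewrite (all1 (C + 2)); last by lra.
have C1 : 1 < C + 2 by lra.
move=> /(_ C1).
have /andP[v0 voo] := volP o 1 ltr01.
rewrite lee_pmul2r//; last by rewrite ge0_fin_numE// ltW.
rewrite lee_fin divr1; apply/negP; rewrite -ltNge.
apply: (@lt_le_trans _ _ (C + 2)); first by rewrite ltrDl.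
by apply: le1r_powR; lra.
Qed.

(** The factor [Lam `^ (nu - p)] is unbounded as [Lam] grows. *)
Lemma exists_large_ratio {R : realType} (theta p nu C : R) :
  0 < theta -> p < nu -> 0 < C ->
  exists Lam : R, [/\ 4 <= Lam, 2 / theta <= Lam &
    2 `^ p * C * Lam `^ p <= 2^-1 * Lam `^ nu].
Proof.
move=> theta0 pnu C0; pose q := nu - p.
have q0 : 0 < q by rewrite subr_gt0.
pose b := 2 * (2 `^ p * C).
have b0 : 0 <= b.
  by apply: mulr_ge0 => //; apply: mulr_ge0; [exact: powR_ge0|exact: ltW].
have th0 : 0 < 2 / theta by rewrite divr_gt0.
have bq : 0 <= b `^ q^-1 by exact: powR_ge0.
exists (4 + 2 / theta + b `^ q^-1); set Lam := (X in [/\ 4 <= X, _ & _]).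
have Lam0 : 0 < Lam by rewrite /Lam; lra.
split; [by rewrite /Lam; lra|by rewrite /Lam; lra|].
have -> : nu = p + q by rewrite /q; lra.
rewrite powRD; last by rewrite (gt_eqF Lam0) implybT.
rewrite [X in _ <= _ * X]mulrC mulrA; apply: ler_wpM2r; first exact: powR_ge0.
suff : b <= Lam `^ q by rewrite /b; lra.
rewrite -[leLHS](powRVK q)//; apply: ler_powR_base => //; first exact: ltW.
by rewrite /Lam; lra.
Qed.

(** * The energy of a smooth function and the Hardy inequality *)

Section GradientEnergy.
Context {R : realType} {n : nat} {M : pmetricType R}.
Variables (S : riemannian_structure n M) (mu : {measure set (borel M) -> \bar R}).
Variables (o : M) (r0 p : R).
Hypothesis p1 : 1 <= p.
Hypothesis volP : forall (x : M) (r : R), 0 < r -> (0 < volume mu x r < +oo)%E.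

Definition gradient_energy (f : M -> R) (E : set M) : R :=
  fine (\int[mu]_(x in (E : set (borel M))) (norm_gradient S f x `^ p)%:E)%E.

(** Smoothness gives continuity, hence measurability, and compactness of the
    support gives boundedness; the Poincare inequality is the one assumed in the
    ends, raised to the power [p]. *)
Lemma gradient_energy_controls (f : M -> R) (C : R) :
  0 < C ->
  (forall x r, admissible o r0 x r ->
    forall h : M -> R, smooth_on S (ball x r) h ->
      mu.-integrable (ball x r) (EFin \o h) ->
      (Lp_norm mu p (ball x r) (fun z => h z - mean mu (ball x r) h)%R
       <= (C * r)%:E * Lp_norm mu p (ball x r) (norm_gradient S h))%E) ->
  smooth_on S [set: M] f -> compact (closure [set x | f x != 0]) ->
  (\int[mu]_x (norm_gradient S f x `^ p)%:E < +oo)%E ->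
  energy_controls mu o (C `^ p) r0 p f (gradient_energy f).
Proof.
move=> C0 PI fS fK Efin.
have p0 : 0 < p by exact: lt_le_trans p1.
have fc := smooth_continuous S f fS.
have mf : measurable_fun [set: borel M] (f : borel M -> R).
  exact: measurable_continuous_borel.
have [b fb] : exists b, forall x, `|f x| <= b.
  have [b bP] := compact_support_bounded f f fc fK.
  exists (Num.max b 0) => x; have [->|fx] := eqVneq (f x) 0.
    by rewrite normr0 le_max lexx orbT.
  by rewrite le_max bP.
have e0 E : (0 <= \int[mu]_(x in (E : set (borel M))) (norm_gradient S f x `^ p)%:E)%E.
  by apply: integral_ge0 => x _; rewrite lee_fin powR_ge0.
have emono (E F : set M) : E `<=` F ->
    (\int[mu]_(x in (E : set (borel M))) (norm_gradient S f x `^ p)%:E <=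
     \int[mu]_(x in (F : set (borel M))) (norm_gradient S f x `^ p)%:E)%E.
  by move=> EF; apply: ge0_le_lower_integral => // x _; rewrite lee_fin powR_ge0.
have efin (E : set M) : (\int[mu]_(x in (E : set (borel M)))
    (norm_gradient S f x `^ p)%:E \is a fin_num)%E.
  by rewrite ge0_fin_numE//; apply: le_lt_trans Efin; exact: emono.
split => //.
- by exists b.
- move=> E F EF; rewrite /gradient_energy fine_ge0//=.
  by apply: fine_le => //; exact: emono.
- move=> D E F DF EF DE; rewrite /gradient_energy -fineD//; apply: fine_le => //.
    by rewrite fin_numD !efin.
  by apply: le_lower_integral_disjoint => // x; rewrite lee_fin powR_ge0.
- move=> x r adm; have r_gt0 : 0 < r by case: adm.
  have Boo : (mu (ball x r) < +oo)%E by case/andP: (volP x r r_gt0).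
  have := PI x r adm f (smooth_on_subset S _ _ _ (@subsetT _ _) fS)
    (integrable_bounded mu (ball x r) f b (measurable_ball _ _) Boo mf fb).
  rewrite !Lp_normE//; under [X in (_ <= _ * X `^ _)%E]eq_integral => z _.
    rewrite [X in X `^ _]ger0_norm; last exact: sqrtr_ge0.
    over.
  set I := (X in (X `^ _ <= _)%E); set J := (X in (_ <= _ * X `^ _)%E) => IJ.
  have I0 : (0 <= I)%E by apply: integral_ge0 => z _; rewrite lee_fin powR_ge0.
  have JE : J = (gradient_energy f (ball x r))%:E by rewrite fineK.
  have Cr0 : 0 <= C * r by rewrite mulr_ge0 ?ltW.
  have : ((I `^ p^-1) `^ p <= ((C * r)%:E * J `^ p^-1) `^ p)%E.
    apply: gt0_ler_poweR => //; first exact: ltW.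
    + by rewrite in_itv/= poweR_ge0 leey.
    + by rewrite in_itv/= leey andbT mule_ge0// poweR_ge0.
  have J0 : (0 <= J)%E by rewrite JE lee_fin fine_ge0.
  have pV : p^-1 * p = 1 by rewrite mulVf ?gt_eqF.
  rewrite poweRM ?poweR_ge0 ?lee_fin//.
  rewrite -(poweRrM I) -(poweRrM J) pV.
  rewrite (poweRe1 I0) (poweRe1 J0).
  by rewrite JE poweR_EFin -EFinM powRM// ?ltW// mulrA.
Qed.

End GradientEnergy.

Theorem theorem2p3 (R : realType) (n : nat) (M : pmetricType R)
    (S : riemannian_structure n M) (mu : {measure set (borel M) -> \bar R})
    (o : M)
    (geodesicM : is_geodesic_distance S)
    (riemannian_mu : is_riemannian_measure S mu)
    (completeM : complete_space (M := M))
    (connectedM : connected [set: M])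
    (noncompactM : ~ compact [set: M])
    (D : doubling mu)
    (RCEo : RCE o) :
  exists2 R0 : R, 0 < R0 & forall r0 : R, R0 <= r0 ->
    forall nu p : R, 1 < nu -> reverse_doubling mu nu -> 1 <= p -> p < nu ->
      poincare_in_ends S mu o r0 p -> hardy S mu o p.
Proof.
have [_ [theta theta01 rce]] := RCEo.
have theta0 : 0 < theta by case/andP: theta01.
(* The anchored ball of radius [R0] has to contain a remote ball around some
   point at distance at least 1 from [o]. *)
have [R0 R0gt0 R0P] : exists2 R0 : R, 0 < R0 &
    (exists x, 1 <= mdist x o) -> exists2 x, 1 <= mdist x o & 2 * mdist x o <= R0.
  have [[x x1]|nex] := pselect (exists x, 1 <= mdist x o); last by exists 1.
  by exists (2 * mdist x o); [lra|move=> _; exists x].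
exists R0 => // r0 R0r0 nu p nu1 rd p1 pnu [C C0 PI].
have p0 : 0 < p by exact: lt_le_trans p1.
have [vo|] := pselect (forall r, 0 < r -> (0 < volume mu o r)%E); last first.
  move=> /existsNP[r /not_implyP[r_gt0 /negP]]; rewrite -leNgt => vr.
  have mu0 : mu [set: borel M] = 0%E.
    apply: (null_measure_of_null_ball mu D o r) => //; apply/eqP.
    by rewrite eq_le vr measure_ge0.
  exists 1 => // f _ _; rewrite (eq_measure_integral mzero); last first.
    move=> A mA _; apply/eqP; rewrite eq_le measure_ge0 andbT /= /mzero -mu0.
    by apply: le_measure => //; rewrite inE.
  rewrite integral_measure_zero mul1e; apply: integral_ge0 => x _.
  by rewrite lee_fin powR_ge0.
have [r1 r1_gt0 vr1] := riemannian_measure_locally_finite S mu o riemannian_mu.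
have volP x r : 0 < r -> (0 < volume mu x r < +oo)%E.
  by move=> r_gt0; rewrite (volume_gt0 mu o D vo)//= (volume_lty mu D o r1).
have [x0 x01 x0R] := R0P (unbounded_of_reverse_doubling mu o nu volP nu1 rd).
have [Crd Crd0 rdP] := rd.
have [Lam [Lam4 Lamtheta Lamnu]] := exists_large_ratio theta p nu Crd theta0 pnu Crd0.
have thetaLam : 1 / theta <= Lam.
  by apply: le_trans Lamtheta; rewrite ler_pM2r ?invr_gt0//; lra.
have [N chain] := RCE_chain o theta Lam theta01 thetaLam rce.
have rdo r r' : 0 < r -> r < r' ->
    (r' / r) `^ nu * fine (volume mu o r) <= Crd * fine (volume mu o r').
  move=> r_gt0 rr'; have := rdP o r r' r_gt0 rr'.
  have r'_gt0 : 0 < r' by exact: lt_trans rr'.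
  rewrite -(volume_fineK mu volP o r r_gt0) -(volume_fineK mu volP o r' r'_gt0).
  by rewrite -!EFinM lee_fin.
have Cp0 : 0 < C `^ p by exact: powR_gt0.
have [C1 C10 decay] := scaled_avg_decay mu o D volP (C `^ p) r0 p Cp0 p1
  theta Lam nu Crd N theta01 Lam4 Lamtheta chain rdo Lamnu.
have x0r0 : 2 * mdist x0 o <= r0 by exact: le_trans R0r0.
have [C2 C20 hardyP] := hardy_of_decay mu o D volP (C `^ p) r0 p theta Lam C1
  Cp0 p1 theta01 Lam4 C10 decay x0 x01 x0r0.
exists C2 => // f fS fK.
have [Einf|Efin] := eqVneq (\int[mu]_x (norm_gradient S f x `^ p)%:E)%E +oo%E.
  by rewrite Einf mulry gtr0_sg// mul1e leey.
have {}Efin : (\int[mu]_x (norm_gradient S f x `^ p)%:E < +oo)%E by rewrite ltey.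
have fG := gradient_energy_controls S mu o r0 p p1 volP f C C0 PI fS fK Efin.
have supp : exists a, forall x, a <= mdist x o -> f x = 0.
  have [b bP] := compact_support_bounded f _ (continuous_rho o) fK.
  exists (b + 1) => x xb; apply/eqP; apply: contraT => /bP.
  by rewrite ger0_norm ?mdist_ge0// => ?; lra.
apply: le_trans (hardyP f _ fG supp) _; rewrite EFinM /gradient_energy fineK//.
by rewrite ge0_fin_numE// integral_ge0// => x _; rewrite lee_fin powR_ge0.
Qed.
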